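(* Let $E$ be a Fréchet space, let $\ell\in\Lambda$, let $A=(a_v^k)$ be a Köthe matrix, and let $\lambda^{\ell}(A)$ be the corresponding $\ell$-Köthe space. Then the following are equivalent: (i) $(E,\lambda^{\ell}(A))\in\mathcal{B}$, i.e. every continuous linear operator from $E$ to $\lambda^{\ell}(A)$ is bounded. (ii) For every sequence $N:\mathbb{N}\to\mathbb{N}$, $k\mapsto N(k)$, there is $N\in\mathbb{N}$ such that for each $r\in\mathbb{N}$ there are $k_0\in\mathbb{N}$ and $C>0$ with $$a_v^{r}\,\|u\|_{N}^{*}\le C\max_{1\le k\le k_0} a_v^{k}\,\|u\|_{N(k)}^{*}$$ for all $v\in\mathbb{N}$ and all $u\in E'$.
   Context: The topology of a Fréchet space $E$ is given by a fixed increasing fundamental sequence of seminorms $(\|\cdot\|_k)_{k\in\mathbb{N}}$. $E'$ is the topological dual of $E$, and for $u\in E'$, $\|u\|_q^{*}=\sup\{|u(x)|: x\in E,\ \|x\|_q\le 1\}\in[0,+\infty]$. In the products $a\,\|u\|_q^*$ with $a\ge 0$, the convention $0\cdot\infty=0$ is used (so that $a\|u\|_q^*$ agrees with the operator seminorm of the corresponding rank-one operator). A Köthe matrix is an infinite matrix $A=(a_n^k)_{n,k\in\mathbb{N}}$ of real numbers with $0\le a_n^k\le a_n^{k+1}$ for all $n,k$ and $\sup_k a_n^k>0$ for every $n$. $\Lambda$ is the class of Banach sequence spaces $\ell$ in which the canonical unit vectors $(e_n)$ form an unconditional basis and whose norm $\|\cdot\|$ is monotone: $\|x\|\le\|y\|$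 whenever $x=(x_n),y=(y_n)\in\ell$ satisfy $|x_n|\le|y_n|$ for all $n$; moreover $\|e_n\|=1$ for all $n$. For $\ell\in\Lambda$ and a Köthe matrix $A$, the $\ell$-Köthe space $\lambda^{\ell}(A)$ is the Fréchet space of all scalar sequences $x=(x_n)$ such that $(x_na_n^k)_n\in\ell$ for every $k$, with seminorms $\|x\|_k=\|(x_na_n^k)_n\|$; thus $\|e_n\|_k=a_n^k$. For a linear operator $T:E\to F$ between Fréchet spaces, $\|T\|_{p,q}=\sup\{\|Tx\|_p:\|x\|_q\le1\}\in[0,+\infty]$. $T$ is continuous if for every $k$ there is $N(k)$ with $\|T\|_{k,N(k)}<\infty$; $T$ is bounded if there is $N\in\mathbb{N}$ with $\|T\|_{r,N}<\infty$ for all $r\in\mathbb{N}$. One writes $(E,F)\in\mathcal{B}$ if every continuous linear operator from $E$ to $F$ is bounded. *)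

(* Defs.v *)
From HB Require Import structures.
From mathcomp Require Import all_boot all_order all_algebra.
From mathcomp Require Import all_classical all_reals all_analysis.
From mathcomp Require Import complex.

Set Implicit Arguments.
Unset Strict Implicit.
Unset Printing Implicit Defensive.

Import Order.TTheory GRing.Theory Num.Theory.
Import numFieldNormedType.Exports.

Local Open Scope classical_set_scope.
Local Open Scope ring_scope.

(* The scalar field is R or R[i]. Norms on modules over [scalar_field R c] take
   their values in [scalar_field R c] itself, so [sabs] is used to read moduli and
   norms as elements of R. *)
Variant scalar_kind := RealScalars | ComplexScalars.

Definition scalar_field (R : realType) (c : scalar_kind) : numFieldType :=
  match c with
  | RealScalars => R : numFieldType
  | ComplexScalars => R[i] : numFieldType
  end.

Definition sabs (R : realType) (c : scalar_kind) : scalar_field R c -> R :=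
  match c return scalar_field R c -> R with
  | RealScalars => fun x : R => `|x|
  | ComplexScalars => fun z : R[i] => Normc.normc z
  end.

Definition of_real (R : realType) (c : scalar_kind) : R -> scalar_field R c :=
  match c return R -> scalar_field R c with
  | RealScalars => fun x : R => x
  | ComplexScalars => fun x : R => Complex x 0
  end.
Arguments of_real {R} c x.

Section SeminormedSpaces.
Context (R : realType) (c : scalar_kind).
Local Notation K := (scalar_field R c).

Definition seminorm (E : lmodType K) (p : E -> R) : Prop :=
  (forall x y, p (x + y) <= p x + p y) /\
  (forall (a : K) x, p (a *: x) = sabs a * p x).

(* Completeness is stated through [p] because [tvsType] does not require its
   uniform structure to be compatible with addition. *)
Record frechet_space (E : tvsType K) (p : nat -> E -> R) : Prop := {
  frechet_hausdorff : hausdorff_space E ;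
  frechet_seminorm : forall k, seminorm (p k) ;
  frechet_increasing : forall k x, p k x <= p k.+1 x ;
  frechet_fundamental : forall U : set E, nbhs 0 U <->
    exists k (e : R), 0 < e /\ [set x | p k x < e] `<=` U ;
  frechet_complete : forall x : nat -> E,
    (forall k (e : R), 0 < e -> exists n0 : nat, forall m n : nat,
      (n0 <= m)%N -> (n0 <= n)%N -> p k (x m - x n) < e) ->
    exists l : E, x @ \oo --> l }.

Definition dual_norm (E : lmodType K) (p : nat -> E -> R) (q : nat)
    (u : E -> K) : \bar R :=
  ereal_sup [set (sabs (u x))%:E | x in [set x | p q x <= 1]].

(* [op_norm pE pF T k q] is the norm from the [q]-th seminorm of the domain to
   the [k]-th seminorm of the codomain. *)
Definition op_norm (E F : lmodType K) (pE : nat -> E -> R) (pF : nat -> F -> R)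
    (T : E -> F) (k q : nat) : \bar R :=
  ereal_sup [set (pF k (T x))%:E | x in [set x | pE q x <= 1]].

Definition continuous_op (E F : lmodType K) (pE : nat -> E -> R)
    (pF : nat -> F -> R) (T : E -> F) : Prop :=
  forall k, exists N, (op_norm pE pF T k N < +oo)%E.

Definition bounded_op (E F : lmodType K) (pE : nat -> E -> R)
    (pF : nat -> F -> R) (T : E -> F) : Prop :=
  exists N, forall r, (op_norm pE pF T r N < +oo)%E.

Definition classB (E F : lmodType K) (pE : nat -> E -> R)
    (pF : nat -> F -> R) : Prop :=
  forall T : {linear E -> F}, continuous_op pE pF T -> bounded_op pE pF T.

End SeminormedSpaces.

Section SequenceSpaces.
Context (R : realType) (c : scalar_kind).
Local Notation K := (scalar_field R c).

Definition unconditional_basis (V : normedModType K) (b : nat -> V) : Prop :=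
  (forall x : V, exists! t : nat -> K,
     series (fun n => t n *: b n) @ \oo --> x) /\
  (forall (t : nat -> K) (s : nat -> nat), bijective s ->
     cvg (series (fun n => t n *: b n) @ \oo) ->
     cvg (series (fun n => t (s n) *: b (s n)) @ \oo)).

(* A Banach space of sequences, presented as a Banach space with an injective
   linear map to the space of all sequences. *)
Record banach_seq_space := BanachSeqSpace {
  bss_space :> completeNormedModType K ;
  bss_coord : bss_space -> nat -> K ;
  bss_coord_linear : forall (a : K) (x y : bss_space) (n : nat),
    bss_coord (a *: x + y) n = a * bss_coord x n + bss_coord y n ;
  bss_coord_inj : injective bss_coord }.

(* The existential only names the unit vectors: [bss_coord] being injective,
   [e] is unique. *)
Definition class_Lambda (l : banach_seq_space) : Prop :=
  exists e : nat -> l,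
    [/\ forall n m, bss_coord (e n) m = (n == m)%:R,
        unconditional_basis e,
        forall x y : l,
          (forall n, sabs (bss_coord x n) <= sabs (bss_coord y n)) ->
          sabs `|x| <= sabs `|y|
      & forall n, sabs `|e n| = 1].

Definition in_seq_space (l : banach_seq_space) (x : nat -> K) : Prop :=
  exists v : l, bss_coord v = x.

(* The norm of the sequence [x] when it belongs to [l]; junk value 0
   otherwise. *)
Definition seq_norm (l : banach_seq_space) (x : nat -> K) : R :=
  sabs `|xget (0 : l) [set v : l | bss_coord v = x]|.

(* In a matrix [a], the entry a_n^k is [a n k]. *)
Definition kothe_matrix (a : nat -> nat -> R) : Prop :=
  (forall n k, 0 <= a n k <= a n k.+1) /\
  (forall n, (0 < ereal_sup (range (fun k => (a n k)%:E)))%E).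

Definition weighted (a : nat -> nat -> R) (k : nat) (x : nat -> K) : nat -> K :=
  fun n => x n * of_real c (a n k).

Definition kothe_mem (l : banach_seq_space) (a : nat -> nat -> R) :
    {pred (nat -> K^o)} :=
  fun x => `[< forall k, in_seq_space l (weighted a k x) >].

Record kothe_space (l : banach_seq_space) (a : nat -> nat -> R) := KotheSpace {
  kothe_seq :> nat -> K^o ;
  _ : kothe_seq \in kothe_mem l a }.

Section Instances.
Context (l : banach_seq_space) (a : nat -> nat -> R).

Lemma kothe_mem_submod_closed : submod_closed (kothe_mem l a).
Proof.
have coord0 n : bss_coord (0 : l) n = 0.
  have := bss_coord_linear (-1) (0 : l) 0 n.
  by rewrite scaler0 addr0 mulN1r addNr.
split.
  apply/asboolP => k; exists 0; apply/funext => n.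
  by rewrite coord0 /weighted mul0r.
move=> t x y /asboolP hx /asboolP hy; apply/asboolP => k.
have [v vx] := hx k; have [w wy] := hy k; exists (t *: v + w).
apply/funext => n; rewrite bss_coord_linear vx wy /weighted mulrA -mulrDl.
by [].
Qed.

HB.instance Definition _ :=
  GRing.isSubmodClosed.Build K (nat -> K^o) (kothe_mem l a)
    kothe_mem_submod_closed.
HB.instance Definition _ := [isSub for @kothe_seq l a].
HB.instance Definition _ := [Choice of kothe_space l a by <:].
HB.instance Definition _ := [SubChoice_isSubLmodule of kothe_space l a by <:].

Definition kothe_seminorm (k : nat) (x : kothe_space l a) : R :=
  seq_norm l (weighted a k x).

End Instances.

End SequenceSpaces.

(* Main.v *)
(* (i) => (ii). If (ii) fails for N(.), a gliding hump gives v_j, u_j, x_j with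
   a_{v_j}^k |u_j| <= 2^-j p_{N(k)} for k <= j, such that T x = sum_j u_j(x) e_{v_j}
   is continuous but is unbounded from every seminorm: the pairs (N, M) are
   enumerated by j, and at stage j the coordinate v_j of T x_j exceeds M although
   p_N(x_j) <= 1.

   (ii) => (i). Let T be continuous with ||T x||_k <= C_k p_{N(k)}(x). Composing the
   section of T over a finite set S of coordinates with a norming functional phi
   gives u in E', and (ii) applied to u and a reference coordinate z bounds the
   section of T over S at level r by comparing the weights at z with those on S.
   A diagonal argument upgrades (ii): for every f some N serves all f' agreeing with
   f on an initial segment. This gives a level N, independent of r, which is applied
   to prefixes f that end in a tail N(g(k)) with g chosen after r. For a given r the
   coordinates are split according to the logarithms of a_v^k / a_v^r for large k:
   there are polynomially many classes of comparable weights at each value t of the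
   logarithm, and each of them has a bound that decays geometrically in t. Hence the
   sections of T are bounded uniformly in S, and T is bounded. *)

From HB Require Import structures.
Require Import Defs.
From mathcomp Require Import all_boot all_order all_algebra.
From mathcomp Require Import all_classical all_reals all_analysis.
From mathcomp Require Import complex.
From mathcomp Require Import zify ring lra.

Set Implicit Arguments.
Unset Strict Implicit.
Unset Printing Implicit Defensive.

Import Order.TTheory GRing.Theory Num.Theory.
Import numFieldNormedType.Exports.

Local Open Scope classical_set_scope.
Local Open Scope ring_scope.

(** * Combinatorics of weights and section bounds *)

Lemma seq_argmin (R : realType) (f : nat -> R) (S : seq nat) :
  S != [::] -> exists2 z, z \in S & forall v, v \in S -> f z <= f v.
Proof.
elim: S => // x [|y S] IH _.
  by exists x; rewrite ?inE // => v; rewrite inE => /eqP ->.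
have [z zS zmin] := IH isT.
have [fxz|fzx] := leP (f x) (f z).
  exists x; first by rewrite inE eqxx.
  by move=> v; rewrite inE => /orP[/eqP->//|/zmin]; apply: le_trans.
exists z; first by rewrite inE zS orbT.
by move=> v; rewrite inE => /orP[/eqP->|/zmin//]; apply: ltW.
Qed.

(* A constant map [d] either dominates at [v], or the value at [d] lies below
   every value at [J d]; in the second case for all relevant [d], [v] is
   handled by the map [d |-> J d], whatever the reference element is. *)
Lemma finite_domination (R : realType) (J : (nat -> nat) -> nat) :
  exists (m : nat) (gs : nat -> nat -> nat),
  forall (beta : nat -> nat -> R) (S : seq nat), S != [::] ->
    (forall v k k', (k <= k')%N -> beta v k <= beta v k') ->
  exists2 zs : nat -> nat, (forall i, zs i \in S) &
    forall v, v \in S -> exists2 i, (i < m)%N &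
      forall k, (k <= J (gs i))%N -> beta (zs i) k <= beta v (gs i k).
Proof.
pose F d := J (fun=> d).
exists (J F).+2, (fun i => if (i <= J F)%N then fun=> i else F).
move=> beta S S0 betam.
have /choice[mins minsP] (i : nat) : exists z, z \in S /\
    forall v, v \in S -> beta z (F i) <= beta v (F i).
  by have [z zS zm] := seq_argmin (fun v => beta v (F i)) S0; exists z.
pose low v := v \in S /\ forall d w, (d <= J F)%N -> w \in S ->
  beta v d <= beta w (F d).
(* [z] must be fixed before [v]: any low element serves, and if there is none the second case below
   never arises, so an arbitrary element will do. *)
have [z zS zlow] : exists2 z, z \in S & (exists v, low v) -> low z.
  have [[v lv]|nlow] := pselect (exists v, low v); first by exists v; case: lv.
  by exists (mins 0%N); [case: (minsP 0%N)|move=> /nlow].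
exists (fun i => if (i <= J F)%N then mins i else z).
  by move=> i; case: ifP => // _; case: (minsP i).
move=> v vS.
have [[d [dJ dv]]|nd] := pselect (exists d, (d <= J F)%N /\
    beta (mins d) (F d) <= beta v d).
  exists d; first by rewrite ltnS ltnW.
  rewrite dJ => k kF; apply: le_trans dv; exact: betam.
exists (J F).+1; rewrite ?ltnS// ltnn => k kF.
have [|_ +] := zlow; last exact.
exists v; split => // d w dJ wS.
have [_ /(_ _ wS)] := minsP d; apply: le_trans.
by rewrite leNgt; apply/negP => /ltW dv; apply: nd; exists d.
Qed.

(** * Integer logarithms *)

Lemma log_exists (R : realType) (b x : R) : 2 <= b -> 1 <= x ->
  exists n : nat, b ^+ n <= x < b ^+ n.+1.
Proof.
move=> b2 x1.
have b1 : 1 <= b by lra.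
have [n xn] : exists n : nat, x < b ^+ n.
  have [n xn] : exists n : nat, x < n%:R.
    by exists (Num.truncn x).+1; rewrite truncnS_gt.
  exists n; apply: lt_le_trans xn _.
  elim: n => [|n IH]; first by rewrite expr0.
  have : 1 <= b ^+ n by exact: exprn_ege1.
  rewrite exprS -natr1; nra.
have ex : exists n, x < b ^+ n by exists n.
case: (ex_minnP ex) => -[|m xm mmin].
  by rewrite expr0; move: x1 => /le_lt_trans /[apply]; rewrite ltxx.
exists m; rewrite xm andbT leNgt; apply/negP => /mmin; lia.
Qed.

(** The default 0 is reached only when no such exponent exists, hence never for [2 <= b] and
    [1 <= x]. *)
Definition ilog (R : realType) (b x : R) : nat :=
  xget 0%N [set n | b ^+ n <= x < b ^+ n.+1].

Lemma ilogP (R : realType) (b x : R) : 2 <= b -> 1 <= x ->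
  b ^+ ilog b x <= x < b ^+ (ilog b x).+1.
Proof.
move=> b2 x1; rewrite /ilog; case: xgetP => // nx.
by have [n nP] := log_exists b2 x1; have := nx n.
Qed.

Lemma ilog_le (R : realType) (b x : R) n : 2 <= b -> 1 <= x ->
  x < b ^+ n.+1 -> (ilog b x <= n)%N.
Proof.
move=> b2 x1 xn; have /andP[lo _] := ilogP b2 x1.
rewrite leqNgt; apply/negP => nl.
have : b ^+ n.+1 <= x by apply: le_trans lo; rewrite ler_weXn2l//; lra.
by rewrite leNgt xn.
Qed.

Lemma ilog_eq (R : realType) (b x y : R) : 2 <= b -> 1 <= x -> 1 <= y ->
  ilog b x = ilog b y -> x <= b * y.
Proof.
move=> b2 x1 y1 xy; have /andP[_ xb] := ilogP b2 x1.
have /andP[yb _] := ilogP b2 y1.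
apply/ltW/(lt_le_trans xb); rewrite exprS xy ler_pM2l//; lra.
Qed.

(** Since T + 1 <= 2^T, a polynomial number (T + 1)^c of classes costs at most 2^(cT), and c < D
    still leaves a gain of 2^T. *)
Lemma expn_bound (R : realType) (T c D : nat) : (c < D)%N ->
  T.+1%:R ^+ c / (2 ^+ D) ^+ T <= 2 ^- T :> R.
Proof.
move=> cD; rewrite ler_pdivrMr ?exprn_gt0// ?exprn_gt0//.
rewrite -(ler_pM2l (x := 2 ^+ T)) ?exprn_gt0// mulrA divff ?expf_neq0//.
rewrite mul1r -exprM -natrX -!natrX -natrM ler_nat.
apply: (@leq_trans (2 ^ T * (2 ^ T) ^ c)).
  by rewrite leq_mul2l; apply/orP; right; case: (c) => // c'; rewrite leq_exp2r// ltn_expl.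
rewrite -expnM -expnD leq_exp2l//; nia.
Qed.

(* An abstraction of the operator and of condition (ii): [bd r q S M] says that the
   section of T over the coordinates in S has norm at most M from the seminorm q to
   the seminorm r, and [X N f] that the inequality of (ii) holds for f with N. *)
Section UniformBounds.
Context (R : realType) (a : nat -> nat -> R)
  (bd : nat -> nat -> seq nat -> R -> Prop)
  (X : nat -> (nat -> nat) -> Prop) (NT : nat -> nat) (CT : nat -> R)
  (a_ge0 : forall v k, 0 <= a v k)
  (a_mono : forall v k k', (k <= k')%N -> a v k <= a v k')
  (bd_mono : forall r q q' (S S' : seq nat) M M', (q <= q')%N -> {subset S' <= S} ->
     M <= M' -> bd r q S M -> bd r q' S' M')
  (bd_cat : forall r q S1 S2 M1 M2,
     bd r q S1 M1 -> bd r q S2 M2 -> bd r q (S1 ++ S2) (M1 + M2))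
  (bd_scale : forall r r' q (S : seq nat) (t M : R), 0 <= t ->
     (forall v, v \in S -> a v r <= t * a v r') ->
     bd r' q S M -> bd r q S (t * M))
  (bd_zero : forall r q (S : seq nat), (forall v, v \in S -> a v r = 0) -> bd r q S 0)
  (bd_cont : forall k S, bd k (NT k) S (CT k))
  (bd_rank_one : forall N f r, X N f -> exists (J : nat) (C : R), 0 < C /\
     forall (S : seq nat) z (B : R), 0 < a z r -> 0 <= B ->
       (forall k, (k <= J)%N -> 0 < a z k ->
          exists2 M, bd r (f k) S M & a z k * M <= B * a z r) ->
       bd r N S (C * B))
  (X_bar : forall f, exists m N, forall f',
     (forall k, (k < m)%N -> f' k = f k) -> X N f').

(** Weights normalised at level [r]: where a_v^r > 0 they equal 1 at [k = r], are at most 1 below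
    and at least 1 above. *)
Let al r v k := a v k / a v r.

Lemma al_mono r v k k' : 0 < a v r -> (k <= k')%N -> al r v k <= al r v k'.
Proof. by move=> av kk; rewrite ler_pM2r ?invr_gt0// a_mono. Qed.

Lemma al_ge0 r v k : 0 <= al r v k.
Proof. by rewrite divr_ge0. Qed.

Lemma al_id r v : 0 < a v r -> al r v r = 1.
Proof. by move=> av; rewrite /al divff// gt_eqF. Qed.

Lemma bd_le r q S M M' : M <= M' -> bd r q S M -> bd r q S M'.
Proof. by move=> MM; apply: bd_mono. Qed.

Lemma bd_sub r q (S S' : seq nat) M : bd r q S M -> {subset S' <= S} -> bd r q S' M.
Proof. by move=> bdS SS; apply: bd_mono bdS. Qed.

Lemma bd_level r q q' S M : (q <= q')%N -> bd r q S M -> bd r q' S M.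
Proof. by move=> qq; apply: bd_mono. Qed.

(** Triangle inequality over finitely many pieces; they may overlap, since [bd] is monotone in the
    set. *)
Lemma bd_cover m (P : nat -> pred nat) r q (S : seq nat) (M : nat -> R) :
  (forall i, (i < m)%N -> bd r q [seq v <- S | P i v] (M i)) ->
  (forall v, v \in S -> exists2 i, (i < m)%N & P i v) ->
  bd r q S (\sum_(i < m) M i).
Proof.
move=> bdP cov.
suff H n : (n <= m)%N ->
    bd r q [seq v <- S | has (fun i => P i v) (iota 0 n)] (\sum_(i < n) M i).
  apply: (bd_sub (H _ (leqnn m))) => v vS.
  rewrite mem_filter vS andbT; apply/hasP.
  by have [i im Pi] := cov v vS; exists i; rewrite // mem_iota.
elim: n => [_|n IH nm].
  rewrite big_ord0; apply: bd_zero => v; by rewrite mem_filter /=.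
rewrite big_ord_recr /=.
apply: (bd_sub (bd_cat (IH (ltnW nm)) (bdP _ nm))) => v.
have iS : iota 0 n.+1 = iota 0 n ++ [:: n] by rewrite -addn1 iotaD.
rewrite mem_cat !mem_filter -[_ || has _ _]/(has (P^~ v) (iota 0 n.+1)).
rewrite iS has_cat /= orbF.
by move=> /andP[/orP[->|->] ->]; rewrite ?orbT.
Qed.

(** The sum of all 2^-t is 2, so the bound does not depend on how many values [tau] takes on [S]. *)
Lemma bd_geometric r q (M : R) (tau : nat -> nat) (S : seq nat) : 0 <= M ->
  (forall t, bd r q [seq v <- S | tau v == t] (M * 2 ^- t)) ->
  bd r q S (2 * M).
Proof.
move=> M0 bdt.
pose m := (\max_(v <- S) tau v).+1.
apply: (@bd_le _ _ _ (\sum_(i < m) M * 2 ^- i)).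
  rewrite -mulr_sumr mulrC ler_wpM2r//.
  have -> : \sum_(i < m) 2 ^- i = 2 - 2 * 2 ^- m :> R.
    elim: (m) => [|n IH]; first by rewrite big_ord0 expr0 invr1; ring.
    by rewrite big_ord_recr /= IH exprS invfM; field; rewrite expf_neq0.
  have : 0 <= 2 ^- m :> R by rewrite invr_ge0 exprn_ge0.
  lra.
apply: (@bd_cover m (fun i v => tau v == i) _ _ _ (fun i => M * 2 ^- i)) => // v vS.
by exists (tau v) => //; rewrite /m ltnS (leq_bigmax_seq v).
Qed.

(** The [c] statistics [phi k] cut [S] into at most (sigma + 1)^c classes; the induction sorts by
    one statistic at a time. *)
Lemma bd_classes r q (M : R) sigma c (phi : nat -> nat -> nat) (S : seq nat) : 0 <= M ->
  (forall v k, v \in S -> (k < c)%N -> (phi k v <= sigma)%N) ->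
  (forall S' : seq nat, {subset S' <= S} ->
    (forall k v w, (k < c)%N -> v \in S' -> w \in S' -> phi k v = phi k w) ->
    bd r q S' M) ->
  bd r q S (M * sigma.+1%:R ^+ c).
Proof.
move=> M0; elim: c S => [|c IH] S phile bdc.
  by rewrite expr0 mulr1; apply: bdc.
have -> : M * sigma.+1%:R ^+ c.+1 = \sum_(i < sigma.+1) M * sigma.+1%:R ^+ c.
  by rewrite sumr_const card_ord exprS -[RHS]mulr_natr; ring.
apply: (@bd_cover sigma.+1 (fun i v => phi c v == i) _ _ _
  (fun=> M * sigma.+1%:R ^+ c)) => [i _|v vS]; last first.
  by exists (phi c v) => //; rewrite ltnS phile.
apply: IH => [v k|S' SS' cst].
  by rewrite mem_filter => /andP[_ vS] kc; apply: phile => //; rewrite ltnW.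
apply: bdc => [v /SS'|k v w]; first by rewrite mem_filter => /andP[].
rewrite ltnS leq_eqVlt => /orP[/eqP->|]; last exact: cst.
by move=> /SS' + /SS'; rewrite !mem_filter => /andP[/eqP-> _] /andP[/eqP-> _].
Qed.

(** Below [e] the given bound at level [q] is used; from [e] on, the continuity bound of T at level
    [g k] is carried to level [r] by comparing the weights on [S] with those at the reference [z].
    [J] and [C] are fixed before [S] and [z]. *)
Lemma bd_reference N e q g r :
  X N (fun k => if (k < e)%N then q else NT (g k)) ->
  exists (J : nat) (C : R), 0 < C /\ forall (S : seq nat) z (B M : R), 0 < a z r -> 0 < B ->
    (forall v, v \in S -> 0 < a v r) -> ((0 < e)%N -> bd r q S M) ->
    (forall k, (k < e)%N -> al r z k * M <= B) ->
    (forall k v, (e <= k)%N -> (k <= J)%N -> v \in S ->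
       al r z k <= B * al r v (g k)) ->
    bd r N S (C * B).
Proof.
move=> /bd_rank_one-/(_ r)[J [C [C0 H]]].
(* [D] absorbs the finitely many continuity constants [CT (g k)]; being at least 1, it also serves
   the indices below [e]. *)
pose D := 1 + \sum_(k < J.+1) `|CT (g k)|.
have D1 : 1 <= D by rewrite lerDl sumr_ge0.
have DC k : (k <= J)%N -> CT (g k) <= D.
  move=> kJ; rewrite /D (bigD1 (Ordinal (kJ : k < J.+1)%N)) //=.
  have := ler_norm (CT (g k)).
  have : 0 <= \sum_(i < J.+1 | i != Ordinal (kJ : (k < J.+1)%N)) `|CT (g i)|.
    exact: sumr_ge0.
  lra.
exists J, (C * D); split; first by rewrite mulr_gt0//; lra.
move=> S z B M az B0 aS bdM lowk highk; rewrite -mulrA; apply: (H S z) => //.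
  by rewrite mulr_ge0 ?ltW//; lra.
move=> k kJ azk; case: ltnP => ke.
  exists M; first by apply: bdM; apply: leq_ltn_trans ke.
  have := lowk k ke; rewrite /al mulrAC ler_pdivrMr// => /le_trans; apply.
  by rewrite ler_pM2r// -[leLHS]mul1r ler_pM2r.
(* [highk] says that a_v^(g k) is at least [al r z k / B] times a_v^r on [S], so the bound at level
   [g k] passes to level [r] with the inverse factor. *)
have t0 : 0 < al r z k / B by rewrite !divr_gt0.
exists ((al r z k / B)^-1 * CT (g k)).
  apply: (bd_scale (r' := g k)); [by rewrite invr_ge0 ltW| |exact: bd_cont].
  move=> v vS; rewrite mulrC ler_pdivlMr// mulrC.
  have := highk k v ke kJ vS.
  by rewrite {2}/al mulrA ler_pdivlMr ?aS// -ler_pdivrMl// mulrA [_^-1 * _]mulrC.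
rewrite /al invf_div !mulrA.
have -> : a z k * B / (a z k / a z r) * CT (g k) = B * a z r * CT (g k).
  by field; rewrite !gt_eqF.
rewrite [D * B]mulrC -!mulrA ler_pM2l// [D * _]mulrC ler_pM2l//; exact: DC.
Qed.

(** The reference is removed by [finite_domination]: finitely many maps [gs] are fixed before [S],
    and every coordinate of [S] is compared through one of them with a reference taken from [S]. The
    transformation [tr] leaves room for levels imposed on an initial segment. *)
Lemma bd_references N e q (tr : (nat -> nat) -> nat -> nat) r :
  (forall g, X N (fun k => if (k < e)%N then q else NT (tr g k))) ->
  exists2 C, 0 < C & forall (S : seq nat) (B M : R), 0 < B ->
    (forall v, v \in S -> 0 < a v r) -> ((0 < e)%N -> bd r q S M) ->
    (forall k z, (k < e)%N -> z \in S -> al r z k * M <= B) ->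
    (forall g k z v, (e <= k)%N -> z \in S -> v \in S ->
       al r z k <= al r v (g k) -> al r z k <= B * al r v (tr g k)) ->
    bd r N S (C * B).
Proof.
move=> XN.
have /choice[JC JCP] g := bd_reference r (XN g).
have {JCP} /choice[CC CCP] g := JCP g.
have [m [gs Hgs]] := @finite_domination R JC.
exists (1 + \sum_(i < m) CC (gs i)).
  apply: ltr_pwDl => //; apply: sumr_ge0 => i _; apply: ltW.
  by have [] := CCP (gs i).
move=> S B M B0 aS bdM lowk highk.
have [->|S0] := eqVneq S [::].
  apply: (@bd_le _ _ _ 0); last by apply: bd_zero.
  rewrite mulr_ge0 ?ltW// ltr_pwDl// sumr_ge0// => i _; apply: ltW.
  by have [] := CCP (gs i).
(* [al_mono] requires a_v^r > 0, which is known on [S]; the value 0 keeps [beta] increasing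
   elsewhere. *)
pose beta v k := if v \in S then al r v k else 0.
have [v k k' kk|zs zsS cov] := Hgs beta S S0.
  by rewrite /beta; case: ifP => // vS; rewrite al_mono// aS.
apply: (@bd_le _ _ _ (\sum_(i < m) CC (gs i) * B)).
  by rewrite -mulr_suml ler_pM2r// lerDr.
pose P i v := `[< forall k, (k <= JC (gs i))%N ->
  al r (zs i) k <= al r v (gs i k) >].
apply: (@bd_cover m P _ _ _ (fun i => CC (gs i) * B)) => [i _|v vS]; last first.
  have [i im iP] := cov v vS; exists i => //; apply/asboolP => k kJ.
  by have := iP k kJ; rewrite /beta zsS vS.
have [_ H] := CCP (gs i).
apply: (H _ (zs i) B M) => //.
- exact: aS.
- by move=> v; rewrite mem_filter => /andP[_ /aS].
- by move=> e0; apply: (bd_sub (bdM e0)) => v; rewrite mem_filter => /andP[].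
- by move=> k ke; apply: lowk.
- move=> k v ek kJ; rewrite mem_filter => /andP[/asboolP/(_ k kJ) ? vS].
  exact: highk.
Qed.

(** [X_bar] gives each g a level and a prefix length valid for every continuation, and
    [finite_domination], applied to the prefix lengths, retains finitely many g. Hence [N0] is fixed
    before [r], and the continuations can then be adapted to [r]. *)
Lemma bd_equivalent_tails : exists N0, forall r, exists (J : nat) (C : R),
  [/\ 0 < C, (r <= J)%N & forall (S : seq nat) (b : R), 1 <= b ->
    (forall v, v \in S -> 0 < a v r) ->
    (forall z v k, (r <= k)%N -> (k <= J)%N -> z \in S -> v \in S ->
       al r z k <= b * al r v k) ->
    bd r N0 S (C * b)].
Proof.
have /choice[mm mmP] g := X_bar (NT \o g).
have {mmP} /choice[NN NNP] g := mmP g.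
have [m [gs Hgs]] := @finite_domination R mm.
exists (\max_(i < m) NN (gs i)) => r.
(* The prefix is kept, so the same level still serves. In the tail, [maxn k r] makes the indices
   below [r] harmless, since [al] is at most 1 there and equals 1 at [r]. *)
pose f i k := if (k < mm (gs i))%N then gs i k else maxn k r.
have Xf i : X (NN (gs i)) (fun k => if (k < 0)%N then 0%N else NT (f i k)).
  by apply: NNP => k km; rewrite /f km.
have /choice[J JP] i := @bd_reference _ 0%N 0%N (f i) r (Xf i).
have {JP} /choice[C CP] i := JP i.
have C0 i : 0 < C i by have [] := CP i.
exists (maxn r (\max_(i < m) J i)), (1 + \sum_(i < m) C i); split.
- by apply: ltr_pwDl => //; apply: sumr_ge0 => i _; apply: ltW.
- exact: leq_maxl.
move=> S b b1 aS cst.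
have b0 : 0 < b by lra.
have [->|S0] := eqVneq S [::].
  apply: (@bd_le _ _ _ 0); last by apply: bd_zero.
  by rewrite mulr_ge0 ?ltW// ltr_pwDl// sumr_ge0// => i _; apply: ltW.
pose beta v k := if v \in S then al r v k else 0.
have [v k k' kk|zs zsS cov] := Hgs beta S S0.
  by rewrite /beta; case: ifP => // vS; rewrite al_mono// aS.
apply: (@bd_le _ _ _ (\sum_(i < m) C i * b)).
  by rewrite -mulr_suml ler_pM2r// lerDr.
pose P i v := `[< forall k, (k <= mm (gs i))%N ->
  al r (zs i) k <= al r v (gs i k) >].
apply: (@bd_cover m P _ _ _ (fun i => C i * b)) => [i im|v vS]; last first.
  have [i im iP] := cov v vS; exists i => //; apply/asboolP => k kJ.
  by have := iP k kJ; rewrite /beta zsS vS.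
have [_ H] := CP i.
apply: (@bd_level _ (NN (gs i))).
  exact: (@leq_bigmax _ (fun i : 'I_m => NN (gs i)) (Ordinal im)).
apply: (H _ (zs i) b 0) => //.
- exact: aS.
- by move=> v; rewrite mem_filter => /andP[_ /aS].
- move=> k v _ kJ; rewrite mem_filter => /andP[/asboolP Pv vS].
  rewrite /f; case: ltnP => km.
    apply: le_trans (Pv k (ltnW km)) _.
    by rewrite -[leLHS]mul1r ler_wpM2r// al_ge0.
  case: (leqP r k) => rk.
    apply: cst => //.
    rewrite leq_max; apply/orP; right; apply: leq_trans kJ _.
    exact: (@leq_bigmax _ (fun i : 'I_m => J i) (Ordinal im)).
  rewrite al_id ?aS// mulr1.
  by apply: le_trans b1; rewrite -(@al_id r (zs i)) ?aS// al_mono ?aS// ltnW.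
Qed.

(* [ilog (al r v r')] measures how large a_v^r' is against a_v^r. On the coordinates
   where it equals T the section is bounded with a factor b^-T, which pays for the
   (T+1)^e3 classes of proportional low-order weights. *)
Lemma bd_slow e e3 N3 r r' : (e <= r)%N -> (e3 <= r)%N -> (r <= r')%N ->
  (forall f, (forall k, (k < e3)%N -> f k = NT (maxn k e)) -> X N3 f) ->
  forall D, (e3 < D)%N -> exists M, forall S : seq nat,
    (forall v, v \in S -> 0 < a v r) ->
    (forall v, v \in S ->
       (2 ^+ D) ^- ilog (2 ^+ D) (al r v r') <= al r v e) ->
    bd r N3 S M.
Proof.
move=> er e3r rr' X3 D De.
(* [X3] imposes the levels [maxn k e] below [e3]; [g] is free only from [e3] on. *)
pose tr (g : nat -> nat) k := if (k < e3)%N then maxn k e else g k.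
have Xtr g : X N3 (fun k => if (k < 0)%N then 0%N else NT (tr g k)).
  by apply: X3 => k ke; rewrite /tr ke.
have [C C0 HU] := @bd_references N3 0%N 0%N tr r' Xtr.
set b := 2 ^+ D : R.
have b2 : 2 <= b by rewrite -[leLHS]expr1 ler_weXn2l ?ler1n//; lia.
have b0 : 0 < b by lra.
pose t v := ilog b (al r v r').
have Cb0 : 0 <= C * b ^+ 2 by rewrite mulr_ge0 ?exprn_ge0 ?ltW.
exists (2 * (C * b ^+ 2)) => S aS slow.
apply: (bd_geometric (tau := t)) => // T.
(* On the stratum [t v = T] the slow condition puts [al r v (maxn k e)] between b^-T and 1, so each
   statistic takes at most T + 1 values. *)
pose phi k v := ilog b (al r v (maxn k e))^-1.
apply: (@bd_le _ _ _ (b ^- T * (C * b ^+ 2) * T.+1%:R ^+ e3)).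
  rewrite mulrC mulrA [X in _ <= X]mulrC ler_wpM2r//; exact: expn_bound.
have low v k : v \in S -> (k < e3)%N -> 1 <= (al r v (maxn k e))^-1.
  move=> vS ke; have ale : 0 < al r v e.
    by apply: lt_le_trans (slow v vS); rewrite invr_gt0 exprn_gt0.
  have alm : 0 < al r v (maxn k e).
    by apply: lt_le_trans ale _; rewrite al_mono ?aS// leq_maxr.
  rewrite invf_ge1// -(@al_id r v) ?aS// al_mono ?aS// geq_max er andbT.
  exact: leq_trans (ltnW ke) e3r.
apply: (@bd_classes _ _ _ _ _ phi).
- by rewrite mulr_ge0// invr_ge0 exprn_ge0// ltW.
- move=> v k; rewrite mem_filter => /andP[/eqP tv vS] ke.
  apply: ilog_le => //; first exact: low.
  have := slow v vS; rewrite -/(t v) tv => slv.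
  have : b ^- T <= al r v (maxn k e).
    by apply: le_trans slv _; rewrite al_mono ?aS// leq_maxr.
  have bT : 0 < b ^- T by rewrite invr_gt0 exprn_gt0.
  move=> bl; have bl' : (al r v (maxn k e))^-1 <= b ^+ T.
    by rewrite -[leRHS]invrK lef_pV2 ?posrE//; apply: lt_le_trans bl.
  apply: le_lt_trans bl' _; rewrite ltr_eXn2l//; lra.
move=> S' SS' cst.
have S'S v : v \in S' -> v \in S /\ t v = T.
  by move=> /SS'; rewrite mem_filter => /andP[/eqP].
have high v : v \in S -> 1 <= al r v r'.
  by move=> vS; rewrite -(@al_id r v) ?aS// al_mono// aS.
(* Descending from level [r'] to [r] yields the decay b^-T; a bound at level [r'] without decay now
   suffices. *)
apply: (bd_scale (r' := r')); first by rewrite invr_ge0 exprn_ge0 ?ltW.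
  move=> v /S'S[vS tv]; have /andP[+ _] := ilogP b2 (high v vS).
  rewrite -/(t v) tv /al ler_pdivlMr ?aS// mulrC => h.
  by rewrite mulrC ler_pdivlMr ?exprn_gt0.
apply: (HU _ _ 0) => //.
- by rewrite exprn_gt0.
- by move=> v /S'S[vS _]; apply: lt_le_trans (aS v vS) _; apply: a_mono.
move=> g k z v _ zS' vS' zv.
have [[zS tz] [vS tv]] := (S'S z zS', S'S v vS').
rewrite /tr; case: ltnP => ke; last first.
  apply: le_trans zv _; rewrite -[leLHS]mul1r ler_wpM2r ?al_ge0//.
  by rewrite exprn_ege1//; lra.
have ar' w : w \in S -> 0 < a w r'.
  by move=> wS; apply: lt_le_trans (aS w wS) _; apply: a_mono.
apply: le_trans (al_mono (k' := maxn k e) (ar' z zS) (leq_maxl _ _)) _.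
(* A ratio at level [r'] is a quotient of two ratios at level [r], each constant on the class up to
   a factor b; hence the factor b^2. *)
have alE w : w \in S -> al r' w (maxn k e) =
    al r w (maxn k e) / al r w r'.
  by move=> wS; rewrite /al; field; rewrite !gt_eqF ?aS ?ar'.
have h1 : al r z (maxn k e) <= b * al r v (maxn k e).
  have := ilog_eq b2 (low v k vS ke) (low z k zS ke) (cst k v z ke vS' zS').
  have := low v k vS ke; have := low z k zS ke.
  set x := al r z _; set y := al r v _ => x1 y1.
  have x0 : 0 < x by rewrite -invr_gt0; lra.
  have y0 : 0 < y by rewrite -invr_gt0; lra.
  by rewrite ler_pdivlMr// mulrC ler_pdivrMr.
have h2 : al r v r' <= b * al r z r'.
  by apply: ilog_eq => //; [exact: high|exact: high|rewrite -!/(t _) tv tz].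
rewrite !alE// mulrA ler_pdivrMr; last by apply: lt_le_trans (high z zS).
rewrite mulrAC ler_pdivlMr; last by apply: lt_le_trans (high v vS).
have := al_ge0 r z (maxn k e); have := al_ge0 r v (maxn k e).
have := high v vS; have := high z zS.
move: h1 h2; set x := al r z _; set y := al r v _; set x' := al r z r'.
set y' := al r v r' => h1 h2 x1 y1 y0 x0.
have -> : b ^+ 2 * y * x' = (b * y) * (b * x') by ring.
by apply: ler_pM => //; lra.
Qed.

(* Here a_v^e is so small against a_v^r that the crude level N0 may be used below e.
   The coordinates are cut into blocks with s v <= 2 t z for all v, z in a block;
   each block is bounded at level N1, and a block lying above some z0 gains the
   factor b^-(t z0) at level N2, which makes the sum over the blocks converge. *)
Lemma bd_fast N0 C J e1 N1 e2 N2 e r :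
  (e1 <= e)%N -> (e2 <= e)%N -> (e <= r)%N -> (r <= J)%N -> 0 < C ->
  (forall (S : seq nat) (b : R), 1 <= b -> (forall v, v \in S -> 0 < a v r) ->
    (forall z v k, (r <= k)%N -> (k <= J)%N -> z \in S -> v \in S ->
       al r z k <= b * al r v k) -> bd r N0 S (C * b)) ->
  (forall f, (forall k, (k < e1)%N -> f k = N0) -> X N1 f) ->
  (forall f, (forall k, (k < e2)%N -> f k = N1) -> X N2 f) ->
  exists J2, forall r', (J <= r')%N -> (J2 <= r')%N ->
  forall D, (J.+1 < D)%N -> exists M, forall S : seq nat,
    (forall v, v \in S -> 0 < a v r) ->
    (forall v, v \in S ->
       al r v e < (2 ^+ D) ^- ilog (2 ^+ D) (al r v r')) ->
    bd r (maxn N1 N2) S M.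
Proof.
move=> e1e e2e er rJ C0 low X1 X2.
have X1' g : X N1 (fun k => if (k < e1)%N then N0 else NT (id g k)).
  by apply: X1 => k ->.
have [C1 C10 HU] := @bd_references N1 e1 N0 id r X1'.
have X2' : X N2 (fun k => if (k < e2)%N then N1 else NT J).
  by apply: X2 => k ->.
have [J2 [C2 [C20 HR]]] := @bd_reference N2 e2 N1 (fun=> J) r X2'.
exists J2 => r' Jr' J2r' D JD.
set b := 2 ^+ D : R.
have b2 : 2 <= b by rewrite -[leLHS]expr1 ler_weXn2l ?ler1n//; lia.
have b0 : 0 < b by lra.
have b1 : 1 <= b by lra.
have Cb0 : 0 <= C * b by rewrite mulr_ge0 ?ltW.
pose t v := ilog b (al r v r').
pose s v := ilog b (al r v J).
(* C b 2^(J+1) bounds C b b^-t (2t+1)^(J+1) for all t, which is what the classes of a block cost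
   below [e1]; the summand 1 serves the indices from [e1] on. *)
pose B := 1 + C * b * 2 ^+ J.+1.
have B1 : 1 <= B by rewrite lerDl mulr_ge0// exprn_ge0.
pose M1 := C1 * B.
have M10 : 0 <= M1 by rewrite mulr_ge0 ?ltW//; lra.
exists (2 * (M1 + 2 * C2 * (1 + M1))) => S aS fast.
have al1 v k : v \in S -> (r <= k)%N -> 1 <= al r v k.
  by move=> vS rk; rewrite -(@al_id r v) ?aS// al_mono// aS.
(* The logarithms at levels [r] to [J] cut a block into at most (2t+1)^(J+1) classes, t being the
   least value of [t] on it; [fast] supplies the compensating factor b^-t. *)
have univ (P : seq nat) : {subset P <= S} ->
    (forall z v, z \in P -> v \in P -> (s v <= 2 * t z)%N) -> bd r N1 P M1.
  move=> PS stP; have [->|P0] := eqVneq P [::].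
    by apply: (@bd_le _ _ _ 0) => //; apply: bd_zero.
  have [z0 z0P z0min] := seq_argmin (fun z => (t z)%:R : R) P0.
  pose M := C * b * (2 * t z0).+1%:R ^+ J.+1.
  have M0 : 0 <= M by rewrite mulr_ge0// exprn_ge0.
  apply: (HU P B M); first lra.
  - by move=> v /PS/aS.
  - move=> _; pose phi k v := ilog b (al r v (maxn k r)).
    apply: (@bd_classes _ _ _ _ _ phi) => // [v k vP kJ|S' S'P cst].
      have vS := PS _ vP.
      apply: leq_trans (stP z0 v z0P vP); apply: ilog_le => //.
        by rewrite al1// leq_maxr.
      have /andP[_] := ilogP b2 (al1 v J vS rJ); apply: le_lt_trans.
      by rewrite al_mono ?aS// geq_max rJ -ltnS kJ.
    apply: low; [lra|by move=> v /S'P/PS/aS|].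
    move=> z v k rk kJ zS' vS'.
    have := cst k z v _ zS' vS'; rewrite /phi (maxn_idPl rk) => H.
    apply: ilog_eq => //; last exact: H.
      by rewrite al1//; apply/PS/S'P.
    by rewrite al1//; apply/PS/S'P.
  - move=> k z ke1 zP.
    have zS := PS _ zP.
    have h1 : al r z k <= b ^- t z0.
      apply: le_trans (_ : al r z e <= _).
        by rewrite al_mono ?aS//; apply: leq_trans e1e; apply: ltnW.
      apply: le_trans (ltW (fast z zS)) _.
      rewrite lef_pV2 ?posrE ?exprn_gt0//; apply: ler_weXn2l => //.
      by have := z0min z zP; rewrite ler_nat.
    apply: le_trans (_ : b ^- t z0 * M <= _); first by rewrite ler_wpM2r.
    have h2 : b ^- t z0 * (2 * t z0).+1%:R ^+ J.+1 <= 2 ^+ J.+1.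
      apply: le_trans (_ : b ^- t z0 * (2 * (t z0).+1%:R) ^+ J.+1 <= _).
        rewrite ler_pM2l ?invr_gt0 ?exprn_gt0//.
        have tt : (2 * t z0).+1%:R <= 2 * (t z0).+1%:R :> R.
          by rewrite -natrM ler_nat mulnS add2n.
        by apply: lerXn2r; rewrite ?nnegrE ?mulr_ge0 ?ler0n.
      rewrite exprMn mulrCA -[leRHS]mulr1 ler_pM2l ?exprn_gt0// mulrC.
      apply: le_trans (expn_bound R (t z0) JD) _.
      by rewrite invf_le1 ?exprn_gt0// exprn_ege1//; lra.
    rewrite /M mulrCA; apply: le_trans (_ : C * b * 2 ^+ J.+1 <= _).
      by rewrite ler_wpM2l.
    by rewrite /B lerDr.
  - move=> g k z v _ zP vP h; apply: le_trans h _.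
    by rewrite -[leLHS]mul1r ler_wpM2r// al_ge0.
(* The label is 1 plus the largest [t z] with [2 * t z < s v], and 0 if there is no such [z]. *)
have /choice[lab labP] v : exists l, v \in S ->
    (l = 0%N /\ forall z, z \in S -> (s v <= 2 * t z)%N) \/
    (exists z0, [/\ z0 \in S, l = (t z0).+1, (2 * t z0 < s v)%N &
      forall z, z \in S -> (t z0 < t z)%N -> (s v <= 2 * t z)%N]).
  pose Q := [seq z <- S | (2 * t z < s v)%N].
  have [Q0|Qn0] := eqVneq Q [::].
    exists 0%N => _; left; split => // z zS; rewrite leqNgt; apply/negP => h.
    by have := in_nil z; rewrite -Q0 mem_filter h zS.
  have [z0 + z0max] := seq_argmin (fun z => - (t z)%:R : R) Qn0.
  rewrite mem_filter => /andP[z0s z0S].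
  exists (t z0).+1 => _; right; exists z0; split => // z zS tz.
  rewrite leqNgt; apply/negP => h.
  have := z0max z; rewrite mem_filter h zS => /(_ isT).
  by rewrite lerN2 ler_nat leqNgt tz.
have st v : v \in S -> (s v <= t v)%N.
  move=> vS; apply: ilog_le => //; first by rewrite al1.
  have /andP[_] := ilogP b2 (al1 v r' vS (leq_trans rJ Jr')).
  by apply: le_lt_trans; rewrite al_mono ?aS.
apply: (bd_geometric (tau := lab)) => [|l].
  by rewrite addr_ge0// !mulr_ge0// ?ltW//; lra.
set P := [seq v <- S | lab v == l].
have PS : {subset P <= S} by move=> v; rewrite mem_filter => /andP[].
have Pl v : v \in P -> lab v = l.
  by rewrite mem_filter => /andP[/eqP].
have bd1 : bd r N1 P M1.
  apply: univ => // z v zP vP.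
  have [[lz _]|[z1 [_ lz z1s _]]] := labP z (PS _ zP).
    have [[_ h]|[z2 [_ lv _ _]]] := labP v (PS _ vP); first by apply/h/PS.
    by move: lv lz; rewrite !Pl// => ->.
  have [[lv _]|[z2 [_ lv _ z2s]]] := labP v (PS _ vP).
    by move: lv lz; rewrite !Pl// => ->.
  (* Equal labels give t z1 = t z2, and 2 t z1 < s z <= t z, so [z] lies beyond the maximum recorded
     for [v]. *)
  apply: z2s; first exact: PS.
  move: lv lz; rewrite !Pl// => -> [->].
  by have := st z (PS _ zP); lia.
have M20 : 0 <= 2 * C2 * (1 + M1) by rewrite !mulr_ge0// ?ltW//; lra.
have [P0|[v0 v0P]] : P = [::] \/ exists v, v \in P.
- by case: (P) => [|v ?]; [left|right; exists v; rewrite inE eqxx].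
- rewrite P0; apply: (@bd_le _ _ _ 0); last by apply: bd_zero.
  by rewrite mulr_ge0 ?addr_ge0// invr_ge0 exprn_ge0.
have [[l0 _]|[z0 [z0S lz z0s _]]] := labP v0 (PS _ v0P).
  move: l0; rewrite Pl// => ->; rewrite expr0 invr1 mulr1.
  by apply: (@bd_mono _ _ _ _ _ _ _ (leq_maxl _ _) _ _ bd1); rewrite ?lerDl.
move: lz; rewrite Pl// => lE.
have bt0 : 0 < b ^- t z0 by rewrite invr_gt0 exprn_gt0.
(* [z0] need not lie in the block. Its weights are at most b^(t z0 + 1), while at level [J] those of
   the block are at least b^(2 t z0 + 1); the quotient is the gain b^-(t z0). *)
have bd2 : bd r N2 P (C2 * (b ^- t z0 * (1 + M1))).
  apply: (HR P z0 _ M1); first exact: aS.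
  - by rewrite mulr_gt0//; lra.
  - by move=> v /PS/aS.
  - by [].
  - move=> k ke2; apply: ler_pM => //; [exact: al_ge0| |lra].
    apply: le_trans (ltW (fast z0 z0S)).
    by rewrite al_mono ?aS//; apply: leq_trans e2e; apply: ltnW.
  - move=> k v ke2 kJ2 vP; have vS := PS _ vP.
    have h1 : al r z0 k <= b ^+ (t z0).+1.
      have /andP[_ /ltW] := ilogP b2 (al1 z0 r' z0S (leq_trans rJ Jr')).
      by apply: le_trans; rewrite al_mono ?aS// (leq_trans kJ2).
    have h2 : b ^+ (2 * t z0).+1 <= al r v J.
      have /andP[+ _] := ilogP b2 (al1 v J vS rJ).
      apply: le_trans; apply: ler_weXn2l => //.
      have [[lv _]|[z2 [_ lv z2s _]]] := labP v vS.
        by move: lv; rewrite Pl// lE.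
      by move: lv z2s; rewrite Pl// lE => -[->].
    apply: le_trans h1 _; apply: le_trans (_ : b ^- t z0 * al r v J <= _).
      rewrite mulrC ler_pdivlMr ?exprn_gt0//; apply: le_trans h2.
      by rewrite -exprD; apply: ler_weXn2l => //; rewrite mul2n -addnn.
    apply: ler_wpM2r; first exact: al_ge0.
    by apply: ler_peMr; [exact: ltW|rewrite lerDl].
apply: (@bd_mono _ _ _ _ _ _ _ (leq_maxr _ _) _ _ bd2) => //.
apply: le_trans (_ : 2 * C2 * (1 + M1) * 2 ^- l <= _); last first.
  by rewrite ler_wpM2r ?invr_ge0 ?exprn_ge0// lerDr.
rewrite lE exprS invfM.
have -> : 2 * C2 * (1 + M1) * (2^-1 * 2 ^- t z0) =
    C2 * (2 ^- t z0 * (1 + M1)) by field; rewrite expf_neq0.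
rewrite ler_pM2l// ler_wpM2r//; first lra.
by rewrite lef_pV2 ?posrE ?exprn_gt0// lerXn2r ?nnegrE//; lra.
Qed.

(** The levels [N0] to [N3] are built one after another before [r0] is given, each from a prefix
    made of earlier data; [J], [r'] and [D] may then depend on [r0]. *)
Lemma uniform_bound : exists N, forall r, exists M, forall S, bd r N S M.
Proof.
have [N0 low] := bd_equivalent_tails.
have [e1 [N1 X1]] := X_bar (fun=> N0).
have [e2 [N2 X2]] := X_bar (fun=> N1).
pose e := maxn e1 e2.
have [e3 [N3 X3]] := X_bar (fun k => NT (maxn k e)).
pose N := maxn (maxn N1 N2) N3.
(* Raising [r0] to [r] strengthens the claim, as the weights increase. *)
exists N => r0; pose r := maxn r0 (maxn e e3).
suff [M HM] : exists M, forall S : seq nat,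
    (forall v, v \in S -> 0 < a v r) -> bd r N S M.
  exists (1 * (M + 0)) => S; apply: (bd_scale (r' := r)) => // [v _|].
    by rewrite mul1r a_mono// leq_maxl.
  pose P v := 0 < a v r.
  apply: (@bd_sub _ _ ([seq v <- S | P v] ++ [seq v <- S | ~~ P v])).
    apply: bd_cat; first by apply: HM => v; rewrite mem_filter => /andP[].
    apply: bd_zero => v; rewrite mem_filter /P => /andP[+ _].
    by rewrite lt_neqAle a_ge0 andbT negbK eq_sym => /eqP.
  by move=> v vS; rewrite mem_cat !mem_filter vS !andbT orbN.
have er : (e <= r)%N := leq_trans (leq_maxl _ _) (leq_maxr _ _).
have e3r : (e3 <= r)%N := leq_trans (leq_maxr _ _) (leq_maxr _ _).
have [J [C [C0 rJ lowJ]]] := low r.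
have [J2 fast] := @bd_fast N0 C J e1 N1 e2 N2 e r
  (leq_maxl _ _) (leq_maxr _ _) er rJ C0 lowJ X1 X2.
(* [D] exceeds [J.+1] and [e3], the exponents in the class counts of the fast and slow parts. *)
pose r' := maxn J J2; pose D := (J + e3).+2.
have [M1 HM1] := fast r' (leq_maxl _ _) (leq_maxr _ _) D ltac:(lia).
have [M2 HM2] := @bd_slow e e3 N3 r r' er e3r
  (leq_trans rJ (leq_maxl _ _)) X3 D ltac:(lia).
exists (M1 + M2) => S aS.
pose P v := al r v e < (2 ^+ D) ^- ilog (2 ^+ D) (al r v r').
apply: (@bd_sub _ _ ([seq v <- S | P v] ++ [seq v <- S | ~~ P v])).
  apply: bd_cat.
    apply: (@bd_level _ (maxn N1 N2)); first exact: leq_maxl.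
    by apply: HM1 => v; rewrite mem_filter => /andP[// _ /aS].
  apply: (@bd_level _ N3); first exact: leq_maxr.
  by apply: HM2 => v; rewrite mem_filter => /andP[nP vS];
    [exact: aS|rewrite leNgt].
by move=> v vS; rewrite mem_cat !mem_filter vS !andbT orbN.
Qed.

End UniformBounds.

(** * Moduli and norms *)

Section Scalars.
Context (R : realType) (c : scalar_kind).
Local Notation K := (scalar_field R c).
Implicit Types (x y : K) (s t : R).

Lemma normE x : `|x| = of_real c (sabs x).
Proof. by move: x; rewrite /sabs /of_real /=; case: c => // -[]. Qed.

Lemma of_real_le s t : (of_real c s <= of_real c t) = (s <= t).
Proof. by rewrite /of_real /=; case: c => //=; rewrite lecE /= eqxx. Qed.

Lemma of_real_lt s t : (of_real c s < of_real c t) = (s < t).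
Proof. by rewrite /of_real /=; case: c => //=; rewrite ltcE /= eqxx. Qed.

Lemma of_realD s t : of_real c (s + t) = of_real c s + of_real c t.
Proof.
by rewrite /of_real /=; case: c => //=; apply/eqP; rewrite eq_complex /= addr0 !eqxx.
Qed.

Lemma of_realM s t : of_real c (s * t) = of_real c s * of_real c t.
Proof.
rewrite /of_real /=; case: c => //=; apply/eqP.
by rewrite eq_complex /= !mul0r !mulr0 subr0 addr0 !eqxx.
Qed.

Lemma of_real0 : of_real c 0 = 0 :> K.
Proof. by rewrite /of_real /=; case: c. Qed.

Lemma of_real1 : of_real c 1 = 1 :> K.
Proof. by rewrite /of_real /=; case: c. Qed.

Lemma of_realN s : of_real c (- s) = - of_real c s.
Proof. by apply/eqP; rewrite -addr_eq0 -of_realD addNr of_real0. Qed.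

Lemma of_real_inj : injective (@of_real R c).
Proof. by move=> s t st; apply/eqP; rewrite eq_le -!of_real_le st lexx. Qed.

Lemma of_real_eq0 s : (of_real c s == 0) = (s == 0).
Proof. by rewrite -of_real0 (inj_eq of_real_inj). Qed.

Lemma sabs_ge0 x : 0 <= sabs x.
Proof. by rewrite -of_real_le of_real0 -normE. Qed.

Lemma sabsD x y : sabs (x + y) <= sabs x + sabs y.
Proof. by rewrite -of_real_le of_realD -!normE ler_normD. Qed.

Lemma sabsM x y : sabs (x * y) = sabs x * sabs y.
Proof. by apply: of_real_inj; rewrite of_realM -!normE normrM. Qed.

Lemma sabs0 : sabs (0 : K) = 0.
Proof. by apply: of_real_inj; rewrite -normE normr0 of_real0. Qed.

Lemma sabs1 : sabs (1 : K) = 1.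
Proof. by apply: of_real_inj; rewrite -normE normr1 of_real1. Qed.

Lemma sabsN x : sabs (- x) = sabs x.
Proof. by apply: of_real_inj; rewrite -!normE normrN. Qed.

Lemma sabs_eq0 x : (sabs x == 0) = (x == 0).
Proof. by rewrite -of_real_eq0 -normE normr_eq0. Qed.

Lemma sabs_of_real s : sabs (of_real c s) = `|s|.
Proof.
have H t : 0 <= t -> sabs (of_real c t) = t.
  move=> t0; apply: of_real_inj; rewrite -normE ger0_norm//.
  by rewrite -of_real0 of_real_le.
have [s0|/ltW s0] := leP 0 s; first by rewrite ger0_norm ?H.
by rewrite ler0_norm// -sabsN -of_realN H// oppr_ge0.
Qed.

Lemma pos_of_real x : 0 < x -> exists2 e : R, 0 < e & x = of_real c e.
Proof.
move=> x0; exists (sabs x).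
  by rewrite -of_real_lt of_real0 -normE gtr0_norm.
by rewrite -normE gtr0_norm.
Qed.

Section Norm.
Context (V : normedModType K).
Implicit Types (v w : V).

Definition nrm v : R := sabs `|v|.

Lemma norm_nrm v : `|v| = of_real c (nrm v).
Proof. by rewrite -[LHS]normr_id normE. Qed.

Lemma nrm_ge0 v : 0 <= nrm v. Proof. exact: sabs_ge0. Qed.

Lemma nrmD v w : nrm (v + w) <= nrm v + nrm w.
Proof. by rewrite -of_real_le of_realD -!norm_nrm ler_normD. Qed.

Lemma nrmZ x v : nrm (x *: v) = sabs x * nrm v.
Proof.
by apply: of_real_inj; rewrite of_realM -!norm_nrm -normE normrZ.
Qed.

Lemma nrm0 : nrm 0 = 0.
Proof. by apply: of_real_inj; rewrite -norm_nrm normr0 of_real0. Qed.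

Lemma nrmN v : nrm (- v) = nrm v.
Proof. by apply: of_real_inj; rewrite -!norm_nrm normrN. Qed.

Lemma nrm_sum (I : Type) (r : seq I) (P : pred I) (f : I -> V) :
  nrm (\sum_(i <- r | P i) f i) <= \sum_(i <- r | P i) nrm (f i).
Proof.
elim/big_rec2: _ => [|i s v _ vs]; first by rewrite nrm0.
by apply: le_trans (nrmD _ _) _; rewrite lerD2l.
Qed.

Lemma cvg_nrm (u : nat -> V) (v : V) : u @ \oo --> v <->
  forall e : R, 0 < e -> exists N, forall n, (N <= n)%N -> nrm (v - u n) < e.
Proof.
rewrite cvgrPdist_lt; split=> H e.
  rewrite -of_real_lt of_real0 => /H[N _ HN]; exists N => n Nn.
  by have := HN n Nn; rewrite /= norm_nrm of_real_lt.
move=> /pos_of_real[d d0 ->]; have [N HN] := H d d0.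
by exists N => // n /= Nn; rewrite norm_nrm of_real_lt HN.
Qed.

End Norm.

Lemma nrm_cauchy (V : completeNormedModType K) (u : nat -> V) :
  (forall e : R, 0 < e -> exists N, forall m n, (N <= m)%N -> (N <= n)%N ->
     nrm (u m - u n) < e) -> exists v : V, u @ \oo --> v.
Proof.
move=> H; suff : cvg (u @ \oo) by exists (lim (u @ \oo)).
apply/cauchy_cvgP/cauchy_ballP => _ /pos_of_real[e e0 ->].
have [N HN] := H e e0.
pose A := [set x | exists2 n, (N <= n)%N & x = u n].
have AF : (u @ \oo) A by exists N => // n Nn; exists n.
exists (A, A) => // -[_ _] [[m Nm ->] [n Nn ->]].
by rewrite -ball_normE /ball_ /= norm_nrm of_real_lt HN.
Qed.

End Scalars.

(** * Norming functionals *)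

Section NormingFunctionals.
Context (R : realType).

Section Sublinear.
Context (c : scalar_kind) (V : lmodType (scalar_field R c)).
Implicit Types (q : V -> R) (x y b : V).

Definition sublinear q := (forall x y, q (x + y) <= q x + q y) /\
  (forall t x, 0 <= t -> q (of_real c t *: x) = t * q x).

(** For sublinear [q] the reverse inequality always holds, so this says q(-b) = -q(b), that is, [q]
    is linear on the real line through [b]. *)
Definition flat q b := q (- b) <= - q b.

Lemma sublinear0 q : sublinear q -> q 0 = 0.
Proof. by move=> [_ /(_ 0 0 (lexx _))]; rewrite scaler0 mul0r. Qed.

Lemma sublinear_opp q x : sublinear q -> - q (- x) <= q x.
Proof.
move=> sq; have [/(_ x (- x)) + _] := sq.
by rewrite subrr sublinear0// => h; lra.
Qed.

Lemma flat_add q b x : sublinear q -> flat q b -> q (x + b) = q x + q b.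
Proof.
move=> sq fb; apply/eqP; rewrite eq_le; have [sD _] := sq; rewrite sD /=.
by have := sD (x + b) (- b); rewrite addrK => h; move: fb; rewrite /flat; lra.
Qed.

Lemma flat_le q q' b : (forall x, q' x <= q x) -> flat q b -> flat q' b.
Proof. by rewrite /flat => le fb; have := le b; have := le (- b); lra. Qed.

(** One step of Hahn-Banach: q'(x) is the infimum over t >= 0 of q(x + t b) - t q(b). It is finite,
    being at least -q(-x), and t = 1 gives the value wanted at -b. *)
Lemma flatten q b : sublinear q ->
  exists2 q', sublinear q' & (forall x, q' x <= q x) /\ q' (- b) <= - q b.
Proof.
move=> sq; have [sD sZ] := sq.
pose A x := [set q (x + of_real c t *: b) - t * q b | t in [set t | 0 <= t]].
have A0 x : A x !=set0 by exists (q (x + of_real c 0 *: b) - 0 * q b), 0 => /=.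
have Alb x : lbound (A x) (- q (- x)).
  move=> _ [t /= t0 <-]; have := sD (x + of_real c t *: b) (- x).
  by rewrite addrC addrA addNr add0r sZ// => h; lra.
have Ab x : has_inf (A x) by split=> //; exists (- q (- x)).
have infle x t : 0 <= t -> inf (A x) <= q (x + of_real c t *: b) - t * q b.
  by move=> t0; apply: ge_inf; [case: (Ab x)|exists t].
have lq x : inf (A x) <= q x.
  by have := infle x 0 (lexx _); rewrite of_real0 scale0r addr0 mul0r subr0.
have ginf x m : (forall t, 0 <= t -> m <= q (x + of_real c t *: b) - t * q b) ->
    m <= inf (A x).
  by move=> h; apply: lb_le_inf => // _ [t /= t0 <-]; exact: h.
exists (fun x => inf (A x)); split=> //.
- move=> x y; rewrite -lerBlDr; apply: (ginf) => t t0.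
  rewrite lerBlDr -lerBlDl; apply: (ginf) => s s0.
  rewrite lerBlDl; apply: le_trans (infle _ (s + t) (addr_ge0 s0 t0)) _.
  have := sD (x + of_real c t *: b) (y + of_real c s *: b).
  rewrite addrACA -scalerDl -of_realD [t + s]addrC => h.
  by lra.
- move=> t x; rewrite le_eqVlt => /orP[/eqP<-|t0].
    rewrite of_real0 scale0r mul0r; apply/eqP; rewrite eq_le.
    have := lq 0; rewrite sublinear0// => -> /=.
    have := lb_le_inf (A0 0) (Alb 0); by rewrite oppr0 sublinear0// oppr0.
  have tK0 : of_real c t != 0 by rewrite of_real_eq0 gt_eqF.
  apply/eqP; rewrite eq_le; apply/andP; split.
    rewrite -ler_pdivrMl//; apply: (ginf) => s s0; rewrite ler_pdivrMl//.
    apply: le_trans (infle _ (t * s) (mulr_ge0 (ltW t0) s0)) _.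
    by rewrite of_realM -scalerA -scalerDr (sZ _ _ (ltW t0)) mulrBr mulrA.
  apply: (ginf) => s s0; rewrite -ler_pdivlMl//.
  have ts0 : 0 <= t^-1 * s by rewrite mulr_ge0// invr_ge0 ltW.
  apply: le_trans (infle _ _ ts0) _.
  rewrite ler_pdivlMl// mulrBr -(sZ _ _ (ltW t0)) scalerDr scalerA -of_realM.
  by rewrite !mulrA divff ?gt_eqF// !mul1r.
- have := infle (- b) 1 ler01.
  by rewrite of_real1 scale1r addNr sublinear0// mul1r sub0r.
Qed.

Lemma flatten_seq q (bs : seq V) : sublinear q ->
  exists2 q', sublinear q' &
    (forall x, q' x <= q x) /\ (forall b, b \in bs -> flat q' b).
Proof.
elim: bs => [|b bs IH] sq; first by exists q.
have [q1 sq1 [q1q fl1]] := IH sq.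
have [q2 sq2 [q2q1 q2b]] := flatten b sq1.
exists q2 => //; split=> [x|d]; first exact: le_trans (q2q1 x) (q1q x).
rewrite inE => /orP[/eqP->|/fl1]; last exact: flat_le.
by apply: le_trans q2b _; rewrite lerN2.
Qed.

End Sublinear.

Lemma nrm_sublinear c (V : normedModType (scalar_field R c)) :
  sublinear (@nrm R c V).
Proof.
split=> [x y|t x t0]; first exact: nrmD.
by rewrite nrmZ sabs_of_real ger0_norm.
Qed.

Lemma norming_sublinear c (V : normedModType (scalar_field R c))
    (bs : seq V) (y : V) :
  exists2 q, sublinear q & [/\ forall x, q x <= nrm x,
    forall b, b \in bs -> flat q b & nrm y <= q y].
Proof.
(* [y] comes first: every later sublinear minorant q2 satisfies q2(y) >= -q2(-y) >= -q1(-y) >=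
   |y|. *)
have [q1 sq1 [q1q q1y]] := flatten y (@nrm_sublinear c V).
have [q2 sq2 [q2q1 q2b]] := flatten_seq bs sq1.
exists q2 => //; split=> // [x|]; first exact: le_trans (q2q1 x) (q1q x).
by have := sublinear_opp y sq2; have := q2q1 (- y); lra.
Qed.

(* [phi] is only linear on the subspace [D]; the real part of [phi] is a
   sublinear functional that is additive along [D]. *)
Lemma norming_functional c (V : normedModType (scalar_field R c))
    (bs : seq V) (y : V) :
  exists (D : V -> Prop) (phi : V -> scalar_field R c),
  [/\ forall b, b \in bs -> D b, D 0,
      forall s w w', D w -> D w' -> D (s *: w + w') /\
        phi (s *: w + w') = s * phi w + phi w',
      forall w, D w -> sabs (phi w) <= nrm w
    & nrm y <= sabs (phi y)].
Proof.
case: c V bs y => V bs y.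
  have [q sq [qn qb yq]] := norming_sublinear bs y.
  pose D w := forall s : R, flat q (s *: w).
  have qZ s w : D w -> q (s *: w) = s * q w.
    move=> Dw; have [s0|/ltW s0] := leP 0 s; first by case: sq => _ ->.
    have := sublinear_opp (s *: w) sq; have := Dw s; rewrite /flat.
    rewrite -scaleNr; have [_ /(_ (- s) w) /= ->] := sq; last by rewrite oppr_ge0.
    by move=> h1 h2; apply: le_anti; apply/andP; split; lra.
  have flD w w' : flat q w -> flat q w' -> flat q (w + w').
    move=> fw fw'; rewrite /flat opprD flat_add//.
    have [sD _] := sq; apply: le_trans (sD _ _) _.
    by move: fw fw'; rewrite /flat; lra.
  exists D, q; split.
  - move=> b /qb fb s; rewrite /flat -scaleNr.
    have fnb : flat q (- b).
      by move: fb; rewrite /flat opprK => ?; lra.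
    have [s0|/ltW s0] := leP 0 s.
      rewrite scaleNr -scalerN; have [_ H] := sq; rewrite !(H s)//.
      by rewrite -mulrN ler_wpM2l.
    have [_ H] := sq; rewrite (H (- s)) ?oppr_ge0//.
    rewrite -[s *: b]opprK -scalerN -scaleNr (H (- s)) ?oppr_ge0//.
    rewrite -mulrN ler_wpM2l ?oppr_ge0//.
    by move: fnb; rewrite /flat opprK.
  - by move=> s; rewrite /flat scaler0 oppr0 sublinear0// oppr0.
  - move=> s w w' Dw Dw'; split.
      by move=> t; rewrite scalerDr scalerA; apply: flD; [exact: Dw|exact: Dw'].
    rewrite flat_add//; last by have := Dw' 1; rewrite scale1r.
    by rewrite qZ.
  - move=> w Dw; rewrite [X in X <= _](_ : _ = `|q w|)// ler_norml qn andbT.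
    have := qn (- w); rewrite nrmN.
    by have := qZ (-1) w Dw; rewrite scaleN1r mulN1r => ->; lra.
  - by apply: le_trans yq _; rewrite [X in _ <= X](_ : _ = `|q y|)// ler_norm.
(* Flattening both b and i b makes [q] flat along the complex line through b. *)
have [q sq [qn qb yq]] := norming_sublinear (bs ++ [seq 'i%C *: b | b <- bs]) y.
pose D w := forall s : R[i], flat q (s *: w).
have flN w : flat q w -> flat q (- w).
  by rewrite /flat opprK; have := sublinear_opp w sq; lra.
have flZ (s : R) w : flat q w -> flat q (s%:C%C *: w).
  move=> fw; have fnw := flN w fw.
  have [s0|/ltW s0] := leP 0 s; have [_ H] := sq.
    rewrite /flat -scalerN; rewrite !(H s)//.
    by rewrite -mulrN ler_wpM2l.
  rewrite -[s%:C%C *: w]opprK; apply: (flN).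
  have -> : - (s%:C%C *: w) = (- s)%:C%C *: w.
    by rewrite -scaleNr; congr (_ *: _); apply/eqP; rewrite eq_complex /= oppr0 !eqxx.
  rewrite /flat -scalerN !(H (- s)) ?oppr_ge0//.
  by rewrite -mulrN ler_wpM2l ?oppr_ge0.
have flD w w' : flat q w -> flat q w' -> flat q (w + w').
  move=> fw fw'; rewrite /flat opprD flat_add//.
  have [sD _] := sq; apply: le_trans (sD _ _) _.
  by move: fw fw'; rewrite /flat; lra.
have qN w : flat q w -> q (- w) = - q w.
  move=> fw; have := sublinear_opp w sq; move: fw; rewrite /flat => h1 h2.
  by apply: le_anti; apply/andP; split; lra.
have qZ (s : R) w : flat q w -> q (s%:C%C *: w) = s * q w.
  move=> fw; have [_ H] := sq.
  have [s0|/ltW s0] := leP 0 s; first by rewrite -H.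
  have -> : s%:C%C *: w = - ((- s)%:C%C *: w).
    by rewrite -scaleNr; congr (_ *: _); apply/eqP; rewrite eq_complex /= opprK oppr0 !eqxx.
  rewrite qN; last exact: flZ.
  by rewrite (H (- s)) ?oppr_ge0// mulNr opprK.
have sE (s : R[i]) : s = (complex.Re s)%:C%C + (complex.Im s)%:C%C * 'i%C.
  by case: s => u v; rewrite [LHS]complexE /= mulrC.
(* The usual complex functional with real part [q]: q(w) - i q(i w). *)
pose phi w := Complex (q w) (- q ('i%C *: w)).
have DZ s w : D w -> D (s *: w) by move=> Dw t; rewrite scalerA; exact: Dw.
have Dfl w : D w -> flat q w by move=> /(_ 1); rewrite scale1r.
have DD w w' : D w -> D w' -> D (w + w').
  by move=> Dw Dw' t; rewrite scalerDr; apply: flD.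
have phiD w w' : D w -> D w' -> phi (w + w') = phi w + phi w'.
  move=> Dw Dw'; apply/eqP; rewrite eq_complex /= scalerDr.
  rewrite flat_add ?flat_add ?opprD ?eqxx//; exact: Dfl.
have phiZ s w : D w -> phi (s *: w) = s * phi w.
  have phiR (t : R) w' : D w' -> phi (t%:C%C *: w') = t%:C%C * phi w'.
    move=> Dw; apply/eqP; rewrite eq_complex /= scalerA ['i%C * _]mulrC -scalerA.
    have fl1 := Dfl _ Dw; have fl2 : flat q ('i%C *: w') := Dw 'i%C.
    rewrite !qZ//.
    by rewrite !mul0r subr0 addr0 mulrN !eqxx.
  have phii w' : D w' -> phi ('i%C *: w') = 'i%C * phi w'.
    move=> Dw; apply/eqP; rewrite eq_complex /= scalerA -expr2 sqr_i scaleN1r.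
    rewrite qN; last exact: Dfl.
    by rewrite !mul0r !mul1r sub0r add0r !opprK !eqxx.
  move=> Dw; rewrite {1}(sE s) scalerDl -scalerA phiD; first last.
  - exact: (DZ _ _ (DZ _ _ Dw)).
  - exact: (DZ _ _ Dw).
  rewrite !phiR//; last exact: (DZ _ _ Dw).
  by rewrite phii// {3}(sE s); ring.
exists D, phi; split.
- move=> b bS s; rewrite (sE s) scalerDl -scalerA.
  apply: flD; apply: flZ; apply: qb; rewrite mem_cat ?bS//.
  by rewrite (map_f (fun b => 'i%C *: b) bS) orbT.
- by move=> s; rewrite /flat scaler0 oppr0 sublinear0// oppr0.
- move=> s w w' Dw Dw'; split; first exact: (DD _ _ (DZ _ _ Dw) Dw').
  by rewrite phiD ?phiZ//; exact: (DZ _ _ Dw).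
- move=> w Dw; pose sb := @sabs R ComplexScalars; rewrite -/(sb _).
  have [->|p0] := eqVneq (phi w) 0; first by rewrite /sb sabs0 nrm_ge0.
  have sp0 : 0 < sb (phi w) by rewrite lt_neqAle sabs_ge0 eq_sym /sb sabs_eq0 p0.
  (* Rotation by the conjugate of phi(w) makes the value real: [q] there equals |phi(w)|^2, while
     the norm is |phi(w)| |w|. *)
  have H := qn ((phi w)^*%C *: w).
  have E : q ((phi w)^*%C *: w) = sb (phi w) ^+ 2.
    have := phiZ (phi w)^*%C w Dw => /(congr1 (@complex.Re R)).
    rewrite {1}/phi /= => ->.
    rewrite /sb /sabs /= sqr_sqrtr ?addr_ge0 ?sqr_ge0//.
    by rewrite !expr2 !mulrNN mulNr opprK.
  move: H; rewrite E nrmZ -/(sb _).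
  have -> : sb (phi w)^*%C = sb (phi w).
    by rewrite /sb /sabs /= sqrrN.
  by rewrite expr2 ler_pM2l.
- apply: le_trans yq _; apply: le_trans (ler_norm _) _.
  rewrite [X in _ <= X](_ : _ = Num.sqrt (q y ^+ 2 + (- q ('i%C *: y)) ^+ 2))//.
  by rewrite -sqrtr_sqr ler_wsqrtr// lerDl sqr_ge0.
Qed.

End NormingFunctionals.

(** * Seminorms and sequence spaces *)

Section SupNorms.
Context (R : realType) (c : scalar_kind).
Local Notation K := (scalar_field R c).
Context (E : lmodType K) (p h : E -> R).
Context (pZ : forall (s : K) x, p (s *: x) = sabs s * p x)
  (hZ : forall (s : K) x, h (s *: x) = sabs s * h x)
  (p_ge0 : forall x, 0 <= p x).

(** Where p(x) > 0, normalise x. Where p(x) = 0, all multiples of x lie in the unit ball, so h(x) >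
    0 would contradict the bound. *)
Lemma homogeneous_bound C : (forall x, p x <= 1 -> h x <= C) ->
  forall x, h x <= C * p x.
Proof.
move=> hC x.
have rZ t y : 0 <= t -> h (of_real c t *: y) = t * h y.
  by move=> t0; rewrite hZ sabs_of_real ger0_norm.
have rpZ t y : 0 <= t -> p (of_real c t *: y) = t * p y.
  by move=> t0; rewrite pZ sabs_of_real ger0_norm.
have [px|px] := leP (p x) 0.
  have px0 : p x = 0 by apply: le_anti; rewrite px p_ge0.
  have H t : 0 <= t -> t * h x <= C.
    by move=> t0; rewrite -rZ//; apply: hC; rewrite rpZ// px0 mulr0.
  rewrite px0 mulr0 leNgt; apply/negP => hx.
  have := H 0 (lexx _); rewrite mul0r => C0.
  have t0 : 0 <= (C + 1) / h x.
    by apply: divr_ge0; [apply: addr_ge0|apply: ltW].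
  by have := H _ t0; rewrite divfK ?gt_eqF//; lra.
have pV : 0 <= (p x)^-1 by rewrite invr_ge0 ltW.
have := hC (of_real c (p x)^-1 *: x); rewrite rpZ// mulVf ?gt_eqF//.
move=> /(_ (lexx _)); rewrite rZ//.
by rewrite ler_pdivrMl// mulrC.
Qed.

Local Notation sup := (ereal_sup [set (h x)%:E | x in [set x | p x <= 1]]).

Lemma sup_leP C : 0 <= C ->
  (sup <= C%:E)%E <-> (forall x, h x <= C * p x).
Proof.
move=> C0; split=> H.
  apply: homogeneous_bound => x px; rewrite -lee_fin.
  by apply: le_trans H; apply: ereal_sup_ubound; exists x.
apply: ge_ereal_sup => _ [x /= px <-]; rewrite lee_fin.
by apply: le_trans (H x) _; rewrite ler_piMr.
Qed.

Lemma sup_ltyP :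
  (sup < +oo)%E <-> exists2 C, 0 <= C & forall x, h x <= C * p x.
Proof.
split; last first.
  by case=> C C0 H; apply: (@le_lt_trans _ _ C%:E); [apply/sup_leP|rewrite ltry].
move=> H; case: (ereal_sup _) H (@sup_leP) => [r _ |//|_] supP.
  exists `|r|; first by [].
  by apply/supP; rewrite ?lee_fin ?ler_norm.
by exists 0 => //; apply/supP; rewrite ?leNye.
Qed.

End SupNorms.

(** * Continuous functionals and seminorm estimates *)

Section Frechet.
Context (R : realType) (c : scalar_kind).
Local Notation K := (scalar_field R c).

Lemma seminorm_ge0 (E : lmodType K) (p : E -> R) : seminorm p ->
  forall x, 0 <= p x.
Proof.
move=> [pD pZ] x; have := pD x (- x); rewrite subrr.
have -> : p (- x) = p x by rewrite -scaleN1r pZ sabsN sabs1 mul1r.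
have -> : p 0 = 0 by rewrite -(scale0r (0 : E)) pZ sabs0 mul0r.
by lra.
Qed.

Lemma linear_sabs (E : lmodType K) (u : {linear E -> K^o}) (s : K) x :
  sabs (u (s *: x) : K) = sabs s * sabs (u x : K).
Proof. by rewrite linearZ sabsM. Qed.

Context (E : tvsType K) (p : nat -> E -> R) (hE : frechet_space p).

Lemma frechet_mono k k' x : (k <= k')%N -> p k x <= p k' x.
Proof.
elim: k' => [|k' IH]; first by rewrite leqn0 => /eqP->.
rewrite leq_eqVlt ltnS => /predU1P[->//|/IH]/le_trans; apply.
exact: frechet_increasing.
Qed.

Lemma bounded_continuous (u : {linear E -> K^o}) k M :
  (forall x, sabs (u x : K) <= M * p k x) -> continuous u.
Proof.
move=> uM x; apply/cvgrPdist_lt => _ /pos_of_real[d d0 ->].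
have p0 := seminorm_ge0 (frechet_seminorm hE k).
have nb : nbhs 0 [set z | p k z < d / (`|M| + 1)].
  apply/(frechet_fundamental hE); exists k, (d / (`|M| + 1)); split=> //.
  by rewrite divr_gt0// ltr_wpDl.
(* Neighbourhoods of x are obtained from those of 0 by continuity of addition at (x, -x). *)
have := @add_continuous E (x : E, - (x : E)) _.
rewrite /= subrr => /(_ _ nb)[[B C] /= [xB xC] BC].
apply: filterS xB => y yB; have /= pz := BC (y, - x) (conj yB (nbhs_singleton xC)).
rewrite distrC -linearB normE of_real_lt.
apply: le_lt_trans (uM _) _; move: pz; rewrite ltr_pdivlMr ?ltr_wpDl// => pz.
apply: le_lt_trans pz; rewrite mulrC ler_wpM2l//.
by apply: le_trans (ler_norm _) _; rewrite lerDl.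
Qed.

Lemma continuous_bounded (u : {linear E -> K^o}) : continuous u ->
  exists k, exists2 M, 0 <= M & forall x, sabs (u x : K) <= M * p k x.
Proof.
move=> /(_ 0)/cvgrPdist_lt/(_ 1 ltr01) nb.
have {nb}/(frechet_fundamental hE)[k [d [d0 H]]] :
  nbhs 0 [set z | sabs (u z : K) < 1].
  apply: filterS nb => z /=; rewrite linear0 sub0r normrN normE.
  by rewrite -(of_real1 R c) of_real_lt.
(* The factor 2 passes from the closed ball to the open one in [H]. *)
exists k, (2 / d); first by rewrite divr_ge0 ?ltW.
move=> x; have [pD pZ] := frechet_seminorm hE k.
have p0 := seminorm_ge0 (frechet_seminorm hE k).
rewrite -[leRHS]mul1r.
apply: (@homogeneous_bound _ _ _ (fun x => 2 / d * p k x) (fun x => sabs (u x : K))).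
- by move=> s y; rewrite pZ mulrCA.
- exact: linear_sabs.
- by move=> y; rewrite mulr_ge0// divr_ge0 ?ltW.
move=> y; rewrite mulrAC ler_pdivrMr// mul1r => py; apply/ltW/H => /=.
by have := p0 y; lra.
Qed.

End Frechet.

(** * Coordinates and finite sections in a Banach sequence space *)

Section SeqSpace.
Context (R : realType) (c : scalar_kind) (l : banach_seq_space R c).
Local Notation K := (scalar_field R c).
Local Notation coord := (@bss_coord R c l).
Implicit Types (x y : l) (n : nat).

Lemma coordD x y n : coord (x + y) n = coord x n + coord y n.
Proof. by rewrite -[x]scale1r bss_coord_linear mul1r scale1r. Qed.

Lemma coord0 n : coord 0 n = 0.
Proof. by apply: (@addrI _ (coord 0 n)); rewrite -coordD !addr0. Qed.

Lemma coordZ s x n : coord (s *: x) n = s * coord x n.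
Proof. by rewrite -[s *: x]addr0 bss_coord_linear coord0 addr0. Qed.

Lemma coordB x y n : coord (x - y) n = coord x n - coord y n.
Proof. by rewrite coordD -scaleN1r coordZ mulN1r. Qed.

Lemma coord_sum (I : Type) (r : seq I) (P : pred I) (f : I -> l) n :
  coord (\sum_(i <- r | P i) f i) n = \sum_(i <- r | P i) coord (f i) n.
Proof. by elim/big_rec2: _ => [|i s v _ <-]; rewrite ?coord0 ?coordD. Qed.

Context (e : nat -> l) (coord_e : forall n m, coord (e n) m = (n == m)%:R).
Context (e_basis : unconditional_basis e).
Context (nrm_mono : forall x y,
  (forall n, sabs (coord x n) <= sabs (coord y n)) -> nrm x <= nrm y).
Context (nrm_e : forall n, nrm (e n) = 1).

Lemma coord_le x n : sabs (coord x n) <= nrm x.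
Proof.
have -> : sabs (coord x n) = nrm (coord x n *: e n) by rewrite nrmZ nrm_e mulr1.
apply: nrm_mono => m; rewrite coordZ coord_e.
by case: eqVneq => [->|_]; rewrite ?mulr1// mulr0 sabs0 sabs_ge0.
Qed.

Lemma cvg_coord (u : nat -> l) x n (t : K) : u @ \oo --> x ->
  (exists N, forall m, (N <= m)%N -> coord (u m) n = t) -> coord x n = t.
Proof.
move=> /cvg_nrm ux [N uN]; apply/eqP; rewrite -subr_eq0 -sabs_eq0.
rewrite eq_le sabs_ge0 andbT leNgt; apply/negP => /ux[N' uN'].
have := uN' (maxn N N') (leq_maxr _ _); rewrite ltNge; apply/negP/negPn.
apply: le_trans (coord_le _ n); rewrite coordB uN// leq_maxl//.
Qed.

(** [undup] makes the list act as a set, so concatenations of overlapping lists are harmless. *)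
Definition vec (S : seq nat) (y : nat -> K) : l :=
  \sum_(v <- undup S) y v *: e v.

Lemma coord_vec S (y : nat -> K) n : coord (vec S y) n = if n \in S then y n else 0.
Proof.
rewrite coord_sum; under eq_bigr do rewrite coordZ coord_e.
have [nS|nS] := boolP (n \in S).
  rewrite (bigD1_seq n) ?mem_undup ?undup_uniq//= eqxx mulr1 big1 ?addr0//.
  by move=> i /negPf->; rewrite mulr0.
rewrite big_seq big1// => i; rewrite mem_undup => iS.
by case: eqVneq nS => [<-|]; rewrite ?iS// mulr0.
Qed.

(** Coordinates are continuous by [coord_le], so the coefficients of the basis expansion are the
    coordinates. *)
Lemma basis_expansion x : (fun n => vec (iota 0 n) (coord x)) @ \oo --> x.
Proof.
have [t [tx _]] := e_basis.1 x.
have vE (f : nat -> K) n : series (fun n => f n *: e n) n = vec (iota 0 n) f.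
  by rewrite /vec undup_id ?iota_uniq// /series /= /index_iota subn0.
have -> : coord x = t.
  apply/funext => n; apply: (cvg_coord (u := series (fun n => t n *: e n))) => //.
  by exists n.+1 => m nm; rewrite vE coord_vec mem_iota add0n nm.
by under eq_fun do rewrite -vE.
Qed.

Lemma nrm_vec_le S S' (y y' : nat -> K) : {subset S <= S'} ->
  (forall v, v \in S -> sabs (y v) <= sabs (y' v)) ->
  nrm (vec S y) <= nrm (vec S' y').
Proof.
move=> SS' yy'; apply: nrm_mono => n; rewrite !coord_vec.
have [nS|nS] := boolP (n \in S); first by rewrite SS'// yy'.
by rewrite sabs0 sabs_ge0.
Qed.

Lemma nrm_vec_cat S S' (y : nat -> K) : nrm (vec (S ++ S') y) <= nrm (vec S y) + nrm (vec S' y).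
Proof.
have -> : vec (S ++ S') y = vec S y + vec [seq v <- S' | v \notin S] y.
  apply: bss_coord_inj; apply/funext => n; rewrite coordD !coord_vec.
  rewrite mem_cat mem_filter; case: (n \in S) => /=; rewrite ?addr0//.
  by rewrite add0r.
apply: le_trans (nrmD _ _) _; rewrite lerD2l; apply: nrm_vec_le => // v.
by rewrite mem_filter => /andP[].
Qed.

Lemma vecZ S (s : K) (y : nat -> K) : vec S (fun v => s * y v) = s *: vec S y.
Proof. by rewrite /vec scaler_sumr; apply: eq_bigr => v _; rewrite scalerA. Qed.

Lemma vecD S (y y' : nat -> K) : vec S (fun v => y v + y' v) = vec S y + vec S y'.
Proof. by rewrite /vec -big_split/=; apply: eq_bigr => v _; rewrite scalerDl. Qed.

Lemma nrm_vec_coord S x : nrm (vec S (coord x)) <= nrm x.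
Proof.
apply: nrm_mono => n; rewrite coord_vec; case: ifP => // _.
by rewrite sabs0 sabs_ge0.
Qed.

Lemma nrm_coord_bound x B : (forall n, nrm (vec (iota 0 n) (coord x)) <= B) -> nrm x <= B.
Proof.
move=> H; apply/ler_addgt0Pr => d d0.
have [N HN] := (cvg_nrm _ _).1 (@basis_expansion x) d d0.
rewrite -[x](subrK (vec (iota 0 N) (coord x))) addrC.
by apply: le_trans (nrmD _ _) _; rewrite lerD// ltW// HN.
Qed.

End SeqSpace.

(** * Seminorms of the Köthe space *)

Section Kothe.
Context (R : realType) (c : scalar_kind) (l : banach_seq_space R c).
Local Notation K := (scalar_field R c).
Context (a : nat -> nat -> R).

Lemma kothe_seminormE k (x : kothe_space l a) :
  exists2 v : l, bss_coord v = weighted a k x & kothe_seminorm k x = nrm v.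
Proof.
have /asboolP/(_ k) : (x : nat -> K^o) \in kothe_mem l a by case: x.
case=> v vx; rewrite /kothe_seminorm /seq_norm.
case: xgetP => [w _ wx|/(_ v)//]; exists w => //.
Qed.

Lemma kothe_seminormP k (x : kothe_space l a) (v : l) :
  bss_coord v = weighted a k x -> kothe_seminorm k x = nrm v.
Proof.
move=> vx; have [w wx ->] := kothe_seminormE k x.
by congr nrm; apply: bss_coord_inj; rewrite vx.
Qed.

Lemma kotheP (s : K) (x y : kothe_space l a) n :
  (s *: x + y : kothe_space l a) n = s * x n + y n.
Proof. by []. Qed.

Lemma kothe_seminormZ k (s : K) (x : kothe_space l a) :
  kothe_seminorm k (s *: x) = sabs s * kothe_seminorm k x.
Proof.
have [v vx ->] := kothe_seminormE k x; rewrite -nrmZ; apply: kothe_seminormP.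
by apply/funext => n; rewrite coordZ vx /weighted mulrA.
Qed.

End Kothe.

(** * Domination implies boundedness *)

Section DualNorms.
Context (R : realType) (c : scalar_kind).
Local Notation K := (scalar_field R c).
Context (E : tvsType K) (p : nat -> E -> R) (hE : frechet_space p).

Lemma dual_norm_leP q (u : {linear E -> K^o}) C : 0 <= C ->
  (dual_norm p q u <= C%:E)%E <-> (forall x, sabs (u x : K) <= C * p q x).
Proof.
apply: sup_leP; first by case: (frechet_seminorm hE q).
  exact: linear_sabs.
exact: seminorm_ge0 (frechet_seminorm hE q).
Qed.

Lemma dual_norm_anti q q' (u : {linear E -> K^o}) : (q <= q')%N ->
  (dual_norm p q' u <= dual_norm p q u)%E.
Proof.
move=> qq'; apply: ge_ereal_sup => _ [x /= px <-]; apply: ereal_sup_ubound.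
by exists x => //=; apply: le_trans px; apply: frechet_mono.
Qed.

Lemma dual_norm_ge0 q (u : {linear E -> K^o}) : (0 <= dual_norm p q u)%E.
Proof.
apply: ereal_sup_ubound; exists 0; last by rewrite linear0 sabs0.
have [_ pZ] := frechet_seminorm hE q.
by rewrite /= -(scale0r (0 : E)) pZ sabs0 mul0r.
Qed.

End DualNorms.

Section Sufficiency.
Context (R : realType) (c : scalar_kind).
Local Notation K := (scalar_field R c).
Context (E : tvsType K) (p : nat -> E -> R) (hE : frechet_space p).
Context (l : banach_seq_space R c) (e : nat -> l).
Context (coord_e : forall n m, bss_coord (e n) m = (n == m)%:R).
Context (e_basis : unconditional_basis e).
Context (nrm_mono : forall x y : l,
  (forall n, sabs (bss_coord x n) <= sabs (bss_coord y n)) -> nrm x <= nrm y).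
Context (nrm_e : forall n, nrm (e n) = 1).
Context (a : nat -> nat -> R) (ha : kothe_matrix a).

Definition dual_domination N (f : nat -> nat) : Prop := forall r : nat,
  exists (k0 : nat) (C : R), 0 < C /\
    forall (v : nat) (u : {linear E -> K^o}), continuous u ->
    ((a v r)%:E * dual_norm p N u <=
     C%:E * \big[maxe/-oo]_(k < k0.+1) ((a v k)%:E * dual_norm p (f k) u))%E.

Lemma kothe_ge0 v k : 0 <= a v k.
Proof. by have /andP[] := ha.1 v k. Qed.

Lemma kothe_le v k k' : (k <= k')%N -> a v k <= a v k'.
Proof.
elim: k' => [|k' IH]; first by rewrite leqn0 => /eqP->.
rewrite leq_eqVlt ltnS => /predU1P[->//|/IH]/le_trans; apply.
by have /andP[] := ha.1 v k'.
Qed.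

Lemma dual_domination_anti N f g : (forall k, f k <= g k)%N ->
  dual_domination N g -> dual_domination N f.
Proof.
move=> fg H r; have [k0 [C [C0 HC]]] := H r; exists k0, C; split=> // v u uc.
apply: le_trans (HC v u uc) _; rewrite lee_pmul2l ?lte_fin//.
apply: le_bigmax2 => k _; apply: lee_wpmul2l; first by rewrite lee_fin kothe_ge0.
exact: dual_norm_anti.
Qed.

Context (dual_dom : forall f, exists N, dual_domination N f).

(* Otherwise, for every m some f_m agreeing with f below m violates the inequality
   with N = m; the pointwise maximum of f and of the f_m with m <= k dominates all
   of them, so it has no N either. *)
Lemma dual_domination_bar f : exists m N, forall f',
  (forall k, (k < m)%N -> f' k = f k) -> dual_domination N f'.
Proof.
apply: contrapT => H.
have /choice[F HF] : forall m, exists f', (forall k, (k < m)%N -> f' k = f k) /\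
    ~ dual_domination m f'.
  move=> m; apply: contrapT => Hm; apply: H; exists m, m => f' ff'.
  by apply: contrapT => Xf'; apply: Hm; exists f'.
have [N HN] := dual_dom (fun k => maxn (f k) (\max_(i < k.+1) F i k)).
apply: (HF N).2; apply: dual_domination_anti HN => k.
have [kN|Nk] := ltnP k N; first by rewrite (HF N).1// leq_maxl.
apply: leq_trans (leq_maxr _ _).
exact: (@leq_bigmax _ (fun i : 'I_k.+1 => F i k) (Ordinal (n := k.+1) Nk)).
Qed.

Context (T : {linear E -> kothe_space l a}) (NT : nat -> nat) (CT : nat -> R).
Context (CT_ge0 : forall k, 0 <= CT k).
Context (T_le : forall k x, kothe_seminorm k (T x) <= CT k * p (NT k) x).

(** The clause [0 <= M] keeps the bound valid when the level [q] is raised. *)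
Definition section_bound r q (S : seq nat) (M : R) : Prop :=
  0 <= M /\ forall x, nrm (vec e S (weighted a r (T x))) <= M * p q x.

Let p_ge0 k x : 0 <= p k x := seminorm_ge0 (frechet_seminorm hE k) x.

Lemma section_bound_cont k S : section_bound k (NT k) S (CT k).
Proof.
split=> // x; apply: le_trans (T_le k x).
have [v <- ->] := kothe_seminormE k (T x).
exact: nrm_vec_coord.
Qed.

Lemma section_bound_mono r q q' (S S' : seq nat) M M' : (q <= q')%N ->
  {subset S' <= S} -> M <= M' -> section_bound r q S M -> section_bound r q' S' M'.
Proof.
move=> qq' SS' MM' [M0 HM]; split; first exact: le_trans MM'.
move=> x; apply: le_trans (_ : M * p q x <= _).
  by apply: le_trans (HM x); apply: nrm_vec_le.
by apply: ler_pM => //; apply: frechet_mono.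
Qed.

Lemma section_bound_cat r q S S' M M' :
  section_bound r q S M -> section_bound r q S' M' ->
  section_bound r q (S ++ S') (M + M').
Proof.
move=> [M0 HM] [M'0 HM']; split; first exact: addr_ge0.
move=> x; rewrite mulrDl; apply: le_trans (lerD (HM x) (HM' x)).
exact: nrm_vec_cat.
Qed.

Lemma section_bound_scale r r' q S t M : 0 <= t ->
  (forall v, v \in S -> a v r <= t * a v r') ->
  section_bound r' q S M -> section_bound r q S (t * M).
Proof.
move=> t0 rr' [M0 HM]; split; first exact: mulr_ge0.
move=> x; rewrite -mulrA; apply: le_trans (ler_wpM2l t0 (HM x)).
rewrite -[X in X * nrm _](ger0_norm t0) -(sabs_of_real c) -nrmZ -vecZ.
apply: nrm_vec_le => // v vS; rewrite /weighted !sabsM !sabs_of_real.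
rewrite mulrCA ler_wpM2l ?sabs_ge0// !ger0_norm ?kothe_ge0//.
exact: rr'.
Qed.

Lemma section_bound_zero r q S : (forall v, v \in S -> a v r = 0) ->
  section_bound r q S 0.
Proof.
move=> S0; split=> // x; rewrite mul0r /vec big_seq big1 ?nrm0// => v.
by rewrite mem_undup => /S0; rewrite /weighted => ->; rewrite of_real0 mulr0 scale0r.
Qed.

Lemma weighted_linear r S (s : K) x y :
  vec e S (weighted a r (T (s *: x + y))) =
  s *: vec e S (weighted a r (T x)) + vec e S (weighted a r (T y)).
Proof.
rewrite -vecZ -vecD /vec; apply: eq_bigr => v _; congr (_ *: _).
by rewrite /weighted linearP kotheP mulrDl mulrA.
Qed.

(* Apply the domination hypothesis to phi o T_S, where T_S is the section of T and
   phi a norm-one functional attaining the norm of T_S x. *)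
Lemma section_bound_rank_one N f r : dual_domination N f ->
  exists (J : nat) (C : R), 0 < C /\ forall S z B, 0 < a z r -> 0 <= B ->
    (forall k, (k <= J)%N -> 0 < a z k ->
       exists2 M, section_bound r (f k) S M & a z k * M <= B * a z r) ->
    section_bound r N S (C * B).
Proof.
move=> Xf; have [J [C [C0 HC]]] := Xf r; exists J, C; split=> // S z B az0 B0 HB.
have CB0 : 0 <= C * B by rewrite mulr_ge0// ltW.
split=> // x.
have [D [phi [De D0 Dlin phi_le y_le]]] :=
  norming_functional [seq e v | v <- S] (vec e S (weighted a r (T x))).
have DS x' : D (vec e S (weighted a r (T x'))).
  rewrite /vec big_seq; apply: (big_rec D) => // v w; rewrite mem_undup => vS Dw.
  by apply: (Dlin _ _ _ _ Dw).1; apply/De/map_f.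
have phi_linear : linear (fun x' => phi (vec e S (weighted a r (T x'))) : K^o).
  by move=> s x1 x2; rewrite weighted_linear (Dlin _ _ _ (DS _) (DS _)).2.
pose u : {linear E -> K^o} := HB.pack (fun x' => phi (vec e S (weighted a r (T x'))) : K^o)
  (GRing.isLinear.Build _ _ _ _ _ phi_linear).
have u_le k M : section_bound r k S M -> forall x', sabs (u x' : K) <= M * p k x'.
  by move=> [_ HM] x'; apply: le_trans (HM x'); apply: phi_le.
have uc : continuous u.
  exact: (bounded_continuous hE (u_le _ _ (section_bound_cont r S))).
suff uN : (dual_norm p N u <= (C * B)%:E)%E.
  by apply: le_trans y_le _; apply: (dual_norm_leP hE N u CB0).1 uN x.
rewrite -(@lee_pmul2l _ (a z r)%:E) ?lte_fin//.
apply: le_trans (HC z u uc) _.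
rewrite -EFinM mulrCA EFinM lee_pmul2l ?lte_fin//.
apply: bigmax_le; first by rewrite leNye.
move=> k _.
(* A vanishing weight kills its term even if the dual norm is infinite, so [HB] concerns positive
   weights only. *)
have [azk|azk] := leP (a z k) 0.
  have -> : a z k = 0 by apply: le_anti; rewrite azk kothe_ge0.
  by rewrite mul0e lee_fin mulr_ge0// ltW.
have [M bM aM] := HB k (ltnSE (ltn_ord k)) azk.
apply: (@le_trans _ _ ((a z k)%:E * M%:E)%E).
  by rewrite lee_pmul2l ?lte_fin//; apply/(dual_norm_leP hE _ _ bM.1)/u_le.
by rewrite -EFinM lee_fin [leRHS]mulrC.
Qed.

(** The finite sections are bounded uniformly at one level [N], and the basis expansion carries the
    bound to [T x]. *)
Lemma dual_domination_bounded_op : bounded_op p (@kothe_seminorm R c l a) T.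
Proof.
have [N HN] := uniform_bound kothe_ge0 kothe_le section_bound_mono section_bound_cat
  section_bound_scale section_bound_zero section_bound_cont section_bound_rank_one
  dual_domination_bar.
exists N => r; have [M HM] := HN r.
apply/sup_ltyP.
- by case: (frechet_seminorm hE N).
- by move=> s x; rewrite linearZ kothe_seminormZ.
- exact: p_ge0.
have M0 : 0 <= M by have [] := HM [::].
exists M => // x; have [v vx ->] := kothe_seminormE r (T x).
apply: (nrm_coord_bound coord_e e_basis nrm_mono nrm_e) => n.
by rewrite vx; apply: (HM (iota 0 n)).2.
Qed.

End Sufficiency.

(** * Geometric series *)

(** Course-of-values recursion: [g n] is the list of the first n choices. *)
Lemma history_choice (X : Type) (P : seq X -> X -> Prop) :
  (forall h, exists x, P h x) ->
  exists f : nat -> X, forall n, P [seq f i | i <- iota 0 n] (f n).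
Proof.
move=> /choice[F HF]; pose g n := iter n (fun h => rcons h (F h)) [::].
exists (fun n => F (g n)) => n; suff -> : [seq F (g i) | i <- iota 0 n] = g n by [].
elim: n => // n IH; rewrite -addn1 iotaD map_cat IH /= add0n addn1.
by rewrite cats1.
Qed.

Section HalfPowers.
Context (R : realType).
Local Notation h n := ((2^-1 : R) ^+ n).

Lemma half_pow_gt0 n : 0 < h n.
Proof. by rewrite exprn_gt0// invr_gt0. Qed.

Lemma half_pow_le1 n : h n <= 1.
Proof. by rewrite exprn_ile1// invf_le1// ler1n. Qed.

Lemma sum_half_pow n m : \sum_(n <= j < m) h j <= 2 * h n.
Proof.
have [nm|/ltnW mn] := leqP n m; last first.
  by rewrite big_geq// mulr_ge0// ltW// half_pow_gt0.
suff -> : \sum_(n <= j < m) h j = 2 * h n - 2 * h m.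
  by have := half_pow_gt0 m; lra.
rewrite -(subnKC nm); elim: (m - n)%N => [|d IH].
  by rewrite addn0 big_geq// subrr.
by rewrite addnS big_nat_recr ?leq_addr//= IH exprS; field.
Qed.

Lemma half_pow_small (e : R) : 0 < e -> exists n, h n < e.
Proof.
move=> e0; exists (Num.bound e^-1); rewrite exprVn -[ltRHS]invrK.
rewrite ltf_pV2 ?posrE ?exprn_gt0 ?invr_gt0//.
apply: (lt_trans (archi_boundP _)); first by rewrite invr_ge0 ltW.
by rewrite -natrX ltr_nat ltn_expl.
Qed.

End HalfPowers.

(** * Geometrically dominated series *)

Section AbsoluteSeries.
Context (R : realType) (c : scalar_kind).
Local Notation K := (scalar_field R c).

Lemma cvg_sabs (u : nat -> K) (t : K) : u @ \oo --> t <->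
  forall e : R, 0 < e -> exists N, forall n, (N <= n)%N -> sabs (t - u n) < e.
Proof.
rewrite cvgrPdist_lt; split=> H e.
  rewrite -(of_real_lt c) of_real0 => /H[N _ HN]; exists N => n Nn.
  by have := HN n Nn; rewrite /= normE of_real_lt.
move=> /pos_of_real[d d0 ->]; have [N HN] := H d d0.
by exists N => // n /= Nn; rewrite normE of_real_lt HN.
Qed.

Lemma nrm_limit_le (V : normedModType K) (u : nat -> V) (w : V) (B : R) :
  u @ \oo --> w -> (forall n, nrm (u n) <= B) -> nrm w <= B.
Proof.
move=> /cvg_nrm uw uB; apply/ler_addgt0Pr => d /uw[N HN].
rewrite -[w](subrK (u N)) addrC.
by apply: le_trans (nrmD _ _) _; rewrite lerD// ltW// HN.
Qed.

Lemma geometric_series_cvg (V : completeNormedModType K) (f : nat -> V) k (P : R) :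
  (forall j, (k <= j)%N -> nrm (f j) <= 2^-1 ^+ j * P) ->
  exists w : V, (fun n => \sum_(0 <= j < n) f j) @ \oo --> w.
Proof.
move=> fP; apply: nrm_cauchy => d d0.
have [N HN] : exists N, (2^-1 : R) ^+ N < d / (2 * (`|P| + 1)).
  by apply: half_pow_small; rewrite divr_gt0// mulr_gt0// ltr_wpDl.
have H m n : (maxn k N <= n)%N -> (n <= m)%N ->
    nrm (\sum_(0 <= j < m) f j - \sum_(0 <= j < n) f j) < d.
  rewrite geq_max => /andP[kn Nn] nm.
  rewrite (big_cat_nat (n := n))//= addrAC subrr add0r.
  apply: le_lt_trans (nrm_sum _ _ _) _.
  apply: (@le_lt_trans _ _ (\sum_(n <= j < m) 2^-1 ^+ j * `|P|)).
    rewrite big_nat_cond [leRHS]big_nat_cond; apply: ler_sum => j.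
    rewrite andbT => /andP[nj _].
    apply: le_trans (fP j (leq_trans kn nj)) _.
    by rewrite ler_wpM2l ?ler_norm// ltW// half_pow_gt0.
  rewrite -mulr_suml; have P1 : 0 < 2 * (`|P| + 1) by rewrite mulr_gt0// ltr_wpDl.
  apply: (@le_lt_trans _ _ (2 * 2^-1 ^+ N * (`|P| + 1))).
    apply: ler_pM => //; [|apply: le_trans (sum_half_pow R n m) _|by rewrite lerDl].
      by apply: sumr_ge0 => j _; apply/ltW/half_pow_gt0.
    by rewrite ler_pM2l// ler_wiXn2l ?invr_ge0// invf_le1// ler1n.
  by rewrite mulrAC mulrC -ltr_pdivlMr.
exists (maxn k N) => m n km kn; have [nm|/ltnW mn] := leqP n m; first exact: H.
by rewrite -nrmN opprB H.
Qed.

End AbsoluteSeries.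

(** * Gliding hump *)

Section GlidingHump.
Context (R : realType) (c : scalar_kind).
Local Notation K := (scalar_field R c).
Context (E : tvsType K) (p : nat -> E -> R) (hE : frechet_space p).
Context (a : nat -> nat -> R) (a_ge0 : forall v k, 0 <= a v k).
Context (Nk r : nat -> nat).
Context (not_dual_dom : forall N (k0 : nat) (C : R), 0 < C ->
  exists v, exists2 u : {linear E -> K^o}, continuous u &
    ~ ((a v (r N))%:E * dual_norm p N u <=
       C%:E * \big[maxe/-oo]_(k < k0.+1) ((a v k)%:E * dual_norm p (Nk k) u))%E).

Let p_ge0 k x : 0 <= p k x := seminorm_ge0 (frechet_seminorm hE k) x.

Lemma scale_functional (s : K) (u : {linear E -> K^o}) :
  exists w : {linear E -> K^o}, forall x, w x = s * u x.
Proof.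
have ul : linear (fun x => s * u x : K^o).
  by move=> t x y; rewrite linearP /= mulrDr mulrCA.
pose w : {linear E -> K^o} :=
  HB.pack (fun x => s * u x : K^o) (GRing.isLinear.Build _ _ _ _ _ ul).
by exists w.
Qed.

(** [B] is the maximum in the violated inequality, finite because an infinite right-hand side would
    make the inequality true; [x] comes from the supremum defining the dual norm on the left. *)
Lemma hump_witness N k0 (C : R) : 0 < C ->
  exists v (u : {linear E -> K^o}) x (B : R), [/\ continuous u, 0 <= B,
    forall k y, (k <= k0)%N -> a v k * sabs (u y : K) <= B * p (Nk k) y,
    p N x <= 1 & C * B < a v (r N) * sabs (u x : K)].
Proof.
move=> C0; have [v [u uc /negP]] := not_dual_dom N k0 C0.
rewrite -ltNge; set Bm := (\big[_/_]_(_ < _) _)%E => Blt.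
have Ble k : (k <= k0)%N -> ((a v k)%:E * dual_norm p (Nk k) u <= Bm)%E.
  move=> kk0; apply: (bigmax_sup (Ordinal (kk0 : (k < k0.+1)%N))) => //=.
have Bge0 : (0 <= Bm)%E.
  apply: le_trans (Ble 0%N (leq0n _)).
  by apply: mule_ge0; [rewrite lee_fin|exact: dual_norm_ge0].
have [B BE] : exists B : R, Bm = B%:E.
  move: Bge0 Blt; case: Bm {Ble} => [B _ _|_|//]; first by exists B.
  by rewrite gt0_muley ?lte_fin// ltNge leey.
move: Bge0 Blt Ble; rewrite BE lee_fin => B0 Blt Ble.
have aN0 : 0 < a v (r N).
  rewrite lt_neqAle a_ge0 andbT eq_sym; apply/eqP => a0.
  by move: Blt; rewrite a0 mul0e -EFinM lte_fin ltNge mulr_ge0// ltW.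
have u_le k y : (k <= k0)%N -> a v k * sabs (u y : K) <= B * p (Nk k) y.
  move=> kk0; have [ak|ak] := leP (a v k) 0.
    have -> : a v k = 0 by apply: le_anti; rewrite ak a_ge0.
    by rewrite mul0r mulr_ge0.
  rewrite mulrC -ler_pdivlMr// mulrAC.
  apply: (dual_norm_leP hE (Nk k) u _).1; first by rewrite divr_ge0// ltW.
  rewrite -(@lee_pmul2l _ (a v k)%:E) ?lte_fin// -EFinM mulrCA divff ?gt_eqF//.
  by rewrite mulr1 Ble.
have [x [px xB]] : exists x, p N x <= 1 /\ C * B < a v (r N) * sabs (u x : K).
  apply: contrapT => nx; move: Blt; rewrite ltNge => /negP; apply.
  rewrite -EFinM -[X in (_ <= X%:E)%E](@mulfVK _ (a v (r N))) ?gt_eqF//.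
  rewrite mulrC EFinM lee_pmul2l ?lte_fin//.
  apply: ge_ereal_sup => _ [x /= px <-]; rewrite lee_fin ler_pdivlMr// mulrC.
  by rewrite leNgt; apply/negP => xB; apply: nx; exists x.
by exists v, u, x, B; split.
Qed.

(** With C = M / eps, rescaling u by eps / B turns [B] into eps and C B into M; if B = 0, any large
    factor works. [s] stands for the contribution of the earlier humps. *)
Lemma hump_step N k0 (eps M : R) (s : nat -> E -> K) : 0 < eps -> 0 < M ->
  exists v (u : {linear E -> K^o}) x, [/\ continuous u,
    forall k y, (k <= k0)%N -> a v k * sabs (u y : K) <= eps * p (Nk k) y,
    p N x <= 1 & M < a v (r N) * sabs (s v x + (u x : K))].
Proof.
move=> eps0 M0; have C0 : 0 < M / eps by rewrite divr_gt0.
have [v [u [x [B [uc B0 u_le px xB]]]]] := hump_witness N k0 C0.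
have {xB}[t [t0 tB xM]] : exists t : R, [/\ 0 <= t, t * B <= eps &
    M < a v (r N) * (t * sabs (u x : K))].
  move: xB; set A := _ * sabs _ => xB.
  have [B00|B00] := leP B 0.
    have B00' : B = 0 by apply: le_anti; rewrite B00 B0.
    move: xB; rewrite B00' mulr0 => A0.
    exists ((M + 1) / A); rewrite mulr0; split; last 1 first.
    - by rewrite mulrCA -/A divfK ?gt_eqF// ltrDl.
    - by apply: divr_ge0; [apply: addr_ge0|]; apply: ltW.
    - exact: ltW.
  exists (eps / B); rewrite divfK ?gt_eqF//; split=> //.
    by apply: divr_ge0; apply: ltW.
  by rewrite mulrCA -/A mulrAC ltr_pdivlMr// [ltRHS]mulrC -ltr_pdivrMr// mulrAC.
(* One of u and -u does not decrease the contribution of the earlier functionals. *)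
have [sg [sg1 sg_le]] : exists sg : K, sabs sg = 1 /\
    t * sabs (u x : K) <= sabs (s v x + of_real c t * sg * (u x : K)).
  pose w : K := of_real c t * (u x : K).
  have wE : sabs w = t * sabs (u x : K) by rewrite sabsM sabs_of_real ger0_norm.
  have := sabsD (s v x + w) (- (s v x - w)).
  rewrite sabsN (_ : _ + - _ = w + w); last by ring.
  have -> : sabs (w + w) = 2 * sabs w.
    have -> : w + w = of_real c 2 * w.
      by rewrite (_ : 2 = 1 + 1 :> R)// of_realD of_real1 mulrDl mul1r.
    by rewrite sabsM sabs_of_real ger0_norm.
  rewrite wE => H.
  have [H1|H1] := leP (t * sabs (u x : K)) (sabs (s v x + w)).
    by exists 1; rewrite sabs1 mulr1.
  exists (-1); rewrite sabsN sabs1 mulrN1 mulNr; split=> //.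
  by rewrite -/w; lra.
have [w wE] := scale_functional (of_real c t * sg) u.
have swE y : sabs (w y : K) = t * sabs (u y : K).
  by rewrite wE !sabsM sg1 mulr1 sabs_of_real ger0_norm.
exists v, w, x; split=> //.
- have [q [D D0 uD]] := continuous_bounded hE uc.
  apply: (@bounded_continuous _ _ _ _ hE w q (t * D)) => y.
  by rewrite swE -mulrA ler_wpM2l.
- move=> k y kk0; rewrite swE mulrCA.
  apply: le_trans (ler_wpM2l t0 (u_le k y kk0)) _.
  by rewrite mulrA ler_wpM2r.
apply: lt_le_trans xM _; apply: ler_wpM2l => //.
by rewrite wE.
Qed.

Lemma hump_sequence (Ns : nat -> nat) (Ms : nat -> R) : (forall j, 0 < Ms j) ->
  exists (v : nat -> nat) (u : nat -> {linear E -> K^o}) (x : nat -> E),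
  [/\ forall j, continuous (u j),
      forall j k y, (k <= j)%N -> a (v j) k * sabs (u j y : K) <= 2^-1 ^+ j * p (Nk k) y,
      forall i j, (i < j)%N ->
        a (v j) (r (Ns i)) * sabs (u j (x i) : K) <= 2^-1 ^+ j,
      forall j, p (Ns j) (x j) <= 1 &
      forall j, Ms j < a (v j) (r (Ns j)) *
        sabs (\sum_(0 <= i < j.+1 | v i == v j) (u i (x j) : K))].
Proof.
move=> Ms0; pose X := (nat * {linear E -> K^o} * E)%type.
have [v0 [u0 [x0 _]]] := hump_step 0 0 (fun _ _ => 0) ltr01 ltr01.
pose z0 : X := (v0, u0, x0).
pose S (h : seq X) := \sum_(0 <= i < size h) p (Nk (r (Ns i))) (nth z0 h i).2.
(* Division by 1 + [S h] makes the new functional small at all earlier points as well. *)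
pose eps h := 2^-1 ^+ size h / (1 + S h).
(* The second term includes the levels [r (Ns i)] of the earlier stages, at which the new functional
   must be small. *)
pose k0 (h : seq X) := maxn (size h) (\max_(i < size h) r (Ns i)).
(* Coordinates may repeat, so earlier humps on the same coordinate are counted. *)
pose s (h : seq X) w y : K :=
  \sum_(0 <= i < size h | (nth z0 h i).1.1 == w) (nth z0 h i).1.2 y.
pose P (h : seq X) (z : X) := [/\ continuous z.1.2,
  forall k y, (k <= k0 h)%N ->
    a z.1.1 k * sabs (z.1.2 y : K) <= eps h * p (Nk k) y,
  p (Ns (size h)) z.2 <= 1 &
  Ms (size h) < a z.1.1 (r (Ns (size h))) * sabs (s h z.1.1 z.2 + (z.1.2 z.2 : K))].
have S0 h : 0 <= S h by apply: sumr_ge0.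
have [|f Pf] := @history_choice X P.
  move=> h; have eps0 : 0 < eps h by rewrite divr_gt0 ?half_pow_gt0// ltr_pwDl.
  have [v [u [x H]]] := hump_step (Ns (size h)) (k0 h) (s h) eps0 (Ms0 (size h)).
  by exists (v, u, x).
pose H n := [seq f i | i <- iota 0 n].
have sH n : size (H n) = n by rewrite size_map size_iota.
have nH n i : (i < n)%N -> nth z0 (H n) i = f i.
  by move=> ni; rewrite (nth_map 0%N) ?size_iota// nth_iota.
have eps_le n k y : eps (H n) * p k y <= 2^-1 ^+ n * p k y.
  rewrite ler_wpM2r// /eps sH ler_pdivrMr ?ltr_pwDl//.
  by apply: ler_peMr; [apply/ltW/half_pow_gt0|rewrite lerDl].
exists (fun j => (f j).1.1), (fun j => (f j).1.2), (fun j => (f j).2); split.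
- by move=> j; have [] := Pf j.
- move=> j k y kj; have [_ H1 _ _] := Pf j.
  apply: le_trans (H1 k y _) (eps_le _ _ _).
  by rewrite /k0 -/(H j) sH leq_max kj.
- move=> i j ij; have [_ H1 _ _] := Pf j.
  apply: le_trans (H1 (r (Ns i)) (f i).2 _) _.
    rewrite /k0 -/(H j) sH leq_max; apply/orP; right.
    exact: (@leq_bigmax _ (fun i : 'I_j => r (Ns i)) (Ordinal ij)).
  rewrite /eps -/(H j) sH mulrAC ler_pdivrMr ?ltr_pwDl//.
  apply: ler_wpM2l; first exact/ltW/half_pow_gt0.
  rewrite /S sH ler_wpDl// (big_cat_nat (n := i)) ?(ltnW ij)//=.
  rewrite [X in _ + X]big_ltn// nH// addrCA lerDl.
  by apply: addr_ge0; apply: sumr_ge0.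
- by move=> j; have [_ _ + _] := Pf j; rewrite -/(H j) sH.
move=> j; have [_ _ _] := Pf j; rewrite -/(H j) /s sH.
rewrite [X in _ -> _ < _ * sabs X]big_mkcond big_nat_recr//= eqxx -big_mkcond /=.
have -> // : \sum_(0 <= i < j | (nth z0 (H j) i).1.1 == (f j).1.1)
    ((nth z0 (H j) i).1.2 (f j).2 : K) =
  \sum_(0 <= i < j | (f i).1.1 == (f j).1.1) ((f i).1.2 (f j).2 : K).
apply: congr_big_nat => // i; first by move=> /andP[_ ij]; rewrite nH ?ij.
by move=> /and3P[_ _ ij]; rewrite nH.
Qed.

End GlidingHump.

(** * The unbounded operator *)

Section HumpOperator.
Context (R : realType) (c : scalar_kind).
Local Notation K := (scalar_field R c).
Context (E : tvsType K) (p : nat -> E -> R) (hE : frechet_space p).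
Context (l : banach_seq_space R c) (e : nat -> l).
Context (coord_e : forall n m, bss_coord (e n) m = (n == m)%:R).
Context (nrm_mono : forall x y : l,
  (forall n, sabs (bss_coord x n) <= sabs (bss_coord y n)) -> nrm x <= nrm y).
Context (nrm_e : forall n, nrm (e n) = 1).
Context (a : nat -> nat -> R) (ha : kothe_matrix a).
Context (Nk : nat -> nat) (v : nat -> nat) (u : nat -> {linear E -> K^o}).
Context (uc : forall j, continuous (u j)).
Context (u_le : forall j k y, (k <= j)%N ->
  a (v j) k * sabs (u j y : K) <= 2^-1 ^+ j * p (Nk k) y).

Let p_ge0 k x : 0 <= p k x := seminorm_ge0 (frechet_seminorm hE k) x.
Let a_ge0 n k : 0 <= a n k := kothe_ge0 ha n k.

Lemma kothe_pos n : exists k, 0 < a n k.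
Proof.
apply: contrapT => H; have := ha.2 n; rewrite ltNge => /negP; apply.
apply: ge_ereal_sup => _ [k _ <-]; rewrite lee_fin leNgt; apply/negP => ak.
by apply: H; exists k.
Qed.

Definition entry_sum n m y : K := \sum_(0 <= j < m | v j == n) (u j y : K).
(** Partial sums of the series of u_j(y) e_(v_j), weighted at level [k] so that they live in [l]. *)
Definition weighted_sum k m y : l :=
  \sum_(0 <= j < m) (of_real c (a (v j) k) * (u j y : K)) *: e (v j).

Lemma coord_weighted_sum k m y n :
  bss_coord (weighted_sum k m y) n = of_real c (a n k) * entry_sum n m y.
Proof.
rewrite coord_sum [entry_sum _ _ _]big_mkcond mulr_sumr; apply: eq_bigr => j _.
rewrite coordZ coord_e; case: eqVneq => [<-|_]; first by rewrite mulr1.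
by rewrite !mulr0.
Qed.

Lemma nrm_weighted_term k j y :
  nrm ((of_real c (a (v j) k) * (u j y : K)) *: e (v j)) =
  a (v j) k * sabs (u j y : K).
Proof. by rewrite nrmZ nrm_e mulr1 sabsM sabs_of_real ger0_norm. Qed.

Lemma weighted_sum_cvg k y : exists w : l, weighted_sum k ^~ y @ \oo --> w.
Proof.
apply: (geometric_series_cvg (k := k) (P := p (Nk k) y)) => j kj.
by rewrite nrm_weighted_term; apply: u_le.
Qed.

Lemma cvg_bss_coord (f : nat -> l) (w : l) n :
  f @ \oo --> w -> (fun m => bss_coord (f m) n : K) @ \oo --> (bss_coord w n : K).
Proof.
move=> /cvg_nrm fw; apply/cvg_sabs => d /fw[N HN]; exists N => m /HN.
by apply: le_lt_trans; rewrite -coordB; apply: (coord_le coord_e nrm_mono nrm_e).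
Qed.

Lemma scalar_cvg_unique (f : nat -> K) (s t : K) :
  f @ \oo --> s -> f @ \oo --> t -> s = t.
Proof. exact: (cvg_unique (@norm_hausdorff K K^o)). Qed.

(** Entry n is read off at a level [kap n] where its weight is positive; uniqueness of limits then
    shows that the limits at all levels come from this one sequence. *)
Lemma entry_sum_cvg y : exists t : nat -> K^o,
  (forall n, entry_sum n ^~ y @ \oo --> (t n : K)) /\
  forall k, exists2 w : l, bss_coord w = weighted a k t &
    weighted_sum k ^~ y @ \oo --> w.
Proof.
have /choice[w wP] := fun k => weighted_sum_cvg k y.
have /choice[kap kapP] := kothe_pos.
pose t n : K := (of_real c (a n (kap n)))^-1 * bss_coord (w (kap n)) n.
have tP n : entry_sum n ^~ y @ \oo --> (t n : K).
  have -> : entry_sum n ^~ y = fun m =>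
      (of_real c (a n (kap n)))^-1 * bss_coord (weighted_sum (kap n) m y) n.
    by apply/funext => m; rewrite coord_weighted_sum mulKf// of_real_eq0 gt_eqF.
  by apply: cvgMr; apply: cvg_bss_coord.
exists t; split=> // k; exists (w k) => //; apply/funext => n.
apply: scalar_cvg_unique (cvg_bss_coord (n := n) (wP k)) _.
under eq_fun do rewrite coord_weighted_sum mulrC.
by apply: cvgMl.
Qed.

Lemma finite_sum_bound k m : exists q, exists2 C, 0 <= C &
  forall y, \sum_(0 <= j < m) a (v j) k * sabs (u j y : K) <= C * p q y.
Proof.
elim: m => [|m [q [C C0 IH]]].
  by exists 0%N, 0 => // y; rewrite big_geq// mul0r.
have [q' [C' C'0 H]] := continuous_bounded hE (uc (j := m)).
exists (maxn q q'), (C + a (v m) k * C'); first by rewrite addr_ge0// mulr_ge0.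
move=> y; rewrite big_nat_recr//= mulrDl; apply: lerD.
  by apply: le_trans (IH y) _; rewrite ler_wpM2l// (frechet_mono hE)// leq_maxl.
rewrite -mulrA ler_wpM2l//; apply: le_trans (H y) _.
by rewrite ler_wpM2l// (frechet_mono hE)// leq_maxr.
Qed.

(** The finitely many terms with j < k are controlled by continuity of each u_j, the others by a
    geometric series of sum at most 2. *)
Lemma weighted_sum_bound k : exists q, exists2 C, 0 <= C &
  forall m y, nrm (weighted_sum k m y) <= C * p q y.
Proof.
have [q [C C0 HC]] := finite_sum_bound k k.
exists (maxn q (Nk k)), (C + 2); first by rewrite addr_ge0.
move=> m y; apply: le_trans (nrm_sum _ _ _) _.
under eq_bigr do rewrite nrm_weighted_term.
have t0 j : 0 <= a (v j) k * sabs (u j y : K) by rewrite mulr_ge0// sabs_ge0.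
apply: (@le_trans _ _ (\sum_(0 <= j < maxn m k) a (v j) k * sabs (u j y : K))).
  rewrite [leRHS](big_cat_nat (n := m)) ?leq_maxl//= lerDl.
  exact: sumr_ge0.
rewrite (big_cat_nat (n := k)) ?leq_maxr//= mulrDl; apply: lerD.
  by apply: le_trans (HC y) _; rewrite ler_wpM2l// (frechet_mono hE)// leq_maxl.
apply: (@le_trans _ _ (\sum_(k <= j < maxn m k) 2^-1 ^+ j * p (Nk k) y)).
  rewrite big_nat_cond [leRHS]big_nat_cond; apply: ler_sum => j.
  by rewrite andbT => /andP[kj _]; apply: u_le.
rewrite -mulr_suml; apply: ler_pM => //.
- by apply: sumr_ge0 => j _; apply/ltW/half_pow_gt0.
- apply: le_trans (sum_half_pow R _ _) _.
  by rewrite ler_piMr// half_pow_le1.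
by rewrite (frechet_mono hE)// leq_maxr.
Qed.

(** T y is the sequence of limits of the entries; the second clause bounds its seminorms from below
    by a single entry of the partial sums. *)
Lemma hump_operator : exists T : {linear E -> kothe_space l a},
  continuous_op p (@kothe_seminorm R c l a) T /\
  forall y k n (t : R), (exists N, forall m, (N <= m)%N ->
    t <= a n k * sabs (entry_sum n m y)) -> t <= kothe_seminorm k (T y).
Proof.
have /choice[t tP] := entry_sum_cvg.
have t_mem y : t y \in kothe_mem l a.
  by apply/asboolP => k; have [w wt _] := (tP y).2 k; exists w.
have t_lin s y y' n : t (s *: y + y') n = s * t y n + t y' n :> K.
  apply: scalar_cvg_unique ((tP _).1 n) _.
  have -> : entry_sum n ^~ (s *: y + y') =
      fun m => s * entry_sum n m y + entry_sum n m y'.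
    apply/funext => m; rewrite /entry_sum mulr_sumr -big_split/=.
    by apply: eq_bigr => j _; rewrite linearP.
  by apply: cvgD; [apply: cvgMr|]; apply: (tP _).1.
have Tl : linear (fun y => KotheSpace (t_mem y)).
  by move=> s y y'; apply/val_inj/funext => n; apply: t_lin.
pose T : {linear E -> kothe_space l a} := HB.pack (fun y => KotheSpace (t_mem y))
  (GRing.isLinear.Build _ _ _ _ _ Tl).
exists T; split=> [k|y k n s [N HN]].
  have [q [C C0 HC]] := weighted_sum_bound k.
  exists q; apply/sup_ltyP.
  - by case: (frechet_seminorm hE q).
  - by move=> s x; rewrite linearZ kothe_seminormZ.
  - exact: p_ge0.
  exists C => // y; have [w wt ww] := (tP y).2 k.
  rewrite (@kothe_seminormP _ _ _ _ k (T y) w)//.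
  by apply: nrm_limit_le ww _ => m; apply: HC.
have [w wt ww] := (tP y).2 k; rewrite (@kothe_seminormP _ _ _ _ k (T y) w)//.
apply/ler_addgt0Pr => d d0.
have [N' HN'] := (cvg_nrm _ _).1 ww d d0.
apply: le_trans (HN (maxn N N') (leq_maxl _ _)) _.
rewrite -[a n k]ger0_norm// -(sabs_of_real c) -sabsM -coord_weighted_sum.
apply: le_trans (coord_le coord_e nrm_mono nrm_e _ _) _.
set z := weighted_sum _ _ _; rewrite -[z](subKr w) ; apply: le_trans (nrmD _ _) _.
by rewrite nrmN lerD2l ltW// HN'// leq_maxr.
Qed.

End HumpOperator.

(** * Boundedness of all continuous operators implies domination *)

Section Necessity.
Context (R : realType) (c : scalar_kind).
Local Notation K := (scalar_field R c).
Context (E : tvsType K) (p : nat -> E -> R) (hE : frechet_space p).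
Context (l : banach_seq_space R c) (e : nat -> l).
Context (coord_e : forall n m, bss_coord (e n) m = (n == m)%:R).
Context (nrm_mono : forall x y : l,
  (forall n, sabs (bss_coord x n) <= sabs (bss_coord y n)) -> nrm x <= nrm y).
Context (nrm_e : forall n, nrm (e n) = 1).
Context (a : nat -> nat -> R) (ha : kothe_matrix a).

Lemma classB_dual_domination : classB p (@kothe_seminorm R c l a) ->
  forall f, exists N, dual_domination p a N f.
Proof.
move=> hB Nk; apply: contrapT => H.
have /choice[r Hr] : forall N, exists r, forall (k0 : nat) (C : R), 0 < C ->
  exists v, exists2 u : {linear E -> K^o}, continuous u &
    ~ ((a v r)%:E * dual_norm p N u <=
       C%:E * \big[maxe/-oo]_(k < k0.+1) ((a v k)%:E * dual_norm p (Nk k) u))%E.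
  move=> N; apply: contrapT => HN; apply: H; exists N => r.
  apply: contrapT => Hr; apply: HN; exists r => k0 C C0.
  apply: contrapT => Hv; apply: Hr; exists k0, C; split=> // v u uc.
  by apply: contrapT => Hle; apply: Hv; exists v, u.
pose NM j : nat * nat := odflt (0%N, 0%N) (unpickle j).
(* The additional 1 in [Ms] pays for the humps after stage j. *)
pose Ns j := (NM j).1; pose Ms j : R := (NM j).2%:R + 1.
have Ms0 j : 0 < Ms j by rewrite ltr_wpDl.
have [v [u [x [uc u_le u_tail px ux]]]] :=
  hump_sequence hE (kothe_ge0 ha) Hr Ns Ms0.
have [T [Tc T_ge]] := hump_operator hE coord_e nrm_mono nrm_e ha uc u_le.
have [N HN] := hB T Tc.
have [C C0 HC] : exists2 C, 0 <= C & forall y, kothe_seminorm (r N) (T y) <= C * p N y.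
  apply/sup_ltyP; last exact: HN.
  - by case: (frechet_seminorm hE N).
  - by move=> s y; rewrite linearZ kothe_seminormZ.
  exact: seminorm_ge0 (frechet_seminorm hE N).
pose j := pickle (N, Num.bound C).
have NMj : NM j = (N, Num.bound C) by rewrite /NM pickleK.
have NsE : Ns j = N by rewrite /Ns NMj.
move: (px j) (ux j) (fun i => u_tail j i); rewrite /Ms NsE NMj /= => pj uj tail.
have := HC (x j); rewrite leNgt => /negP; apply.
apply: (@le_lt_trans _ _ C); first by rewrite ler_piMr.
apply: (lt_le_trans (archi_boundP C0)).
apply: (T_ge _ _ (v j)); exists j.+1 => m jm.
rewrite /entry_sum (big_cat_nat (n := j.+1))//=.
set s := \sum_(0 <= i < _ | _) _ in uj *.
set s' := \sum_(_ <= i < m | _) _.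
have s_le : sabs s <= sabs (s + s') + sabs s'.
  by rewrite -{1}[s](addrK s') -(sabsN s') sabsD.
(* At x_j the later humps sum to at most 2^-(j+1) + 2^-(j+2) + ... = 2^-j <= 1. *)
have s'_le : a (v j) (r N) * sabs s' <= 1.
  apply: (@le_trans _ _ (\sum_(j.+1 <= i < m) 2^-1 ^+ i)); last first.
    apply: le_trans (sum_half_pow R _ _) _.
    by rewrite exprS mulrA divff// mul1r half_pow_le1.
  have nrmE (z : K^o) : nrm z = sabs (z : K).
    by rewrite /nrm normE sabs_of_real ger0_norm// sabs_ge0.
  rewrite -nrmE.
  apply: le_trans (ler_wpM2l (kothe_ge0 ha _ _) (nrm_sum _ _ _)) _.
  rewrite mulr_sumr big_mkcond big_nat_cond [leRHS]big_nat_cond.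
  apply: ler_sum => i; rewrite andbT => /andP[ji _].
  case: eqVneq => [vi|_]; last exact/ltW/half_pow_gt0.
  by rewrite nrmE -vi; apply: tail.
have := ler_wpM2l (kothe_ge0 ha (v j) (r N)) s_le.
by rewrite mulrDr; lra.
Qed.

End Necessity.

Theorem theorem2p3 (R : realType) (c : scalar_kind)
    (E : tvsType (scalar_field R c)) (p : nat -> E -> R) (hE : frechet_space p)
    (l : banach_seq_space R c) (hl : class_Lambda l)
    (a : nat -> nat -> R) (ha : kothe_matrix a) :
  classB p (@kothe_seminorm R c l a) <->
  (forall Nk : nat -> nat, exists N : nat, forall r : nat,
     exists (k0 : nat) (C : R), 0 < C /\
       forall (v : nat) (u : {linear E -> (scalar_field R c)^o}), continuous u ->
         ((a v r)%:E * dual_norm p N u <=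
          C%:E * \big[maxe/-oo]_(k < k0.+1) ((a v k)%:E * dual_norm p (Nk k) u))%E).
Proof.
have [e [coord_e e_basis nrm_mono nrm_e]] := hl.
split; first exact: (classB_dual_domination hE coord_e nrm_mono nrm_e ha).
move=> dom T /choice[NT T_lt].
have /choice[CT T_le] : forall k, exists C, 0 <= C /\
    forall x, kothe_seminorm k (T x) <= C * p (NT k) x.
  move=> k; suff [C C0 HC] : exists2 C, 0 <= C &
      forall x, kothe_seminorm k (T x) <= C * p (NT k) x by exists C.
  apply/sup_ltyP; last exact: T_lt.
  - by case: (frechet_seminorm hE (NT k)).
  - by move=> s x; rewrite linearZ kothe_seminormZ.
  exact: seminorm_ge0 (frechet_seminorm hE (NT k)).
exact: (dual_domination_bounded_op hE coord_e e_basis nrm_mono nrm_e ha dom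
  (fun k => (T_le k).1) (fun k => (T_le k).2)).
Qed.
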